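(* Let $F_1$ be the distribution function of the degenerate distribution at the origin. Let $F_2$ be the distribution function of a nondegenerate probability distribution $\{p_x : x=0,\pm 1,\pm 2,\ldots\}$ on the integers for which there exist a constant $K>0$ and a sequence $\{v_j : j=\pm 1,\pm 2,\ldots\}$ of nonnegative real numbers such that both sequences $\{v_{-j} : j=1,2,\ldots\}$ and $\{v_j : j=1,2,\ldots\}$ are log-convex and $$ K p_x = \begin{cases} \sum_{j=|x|+1}^{\infty} v_{-j} & \text{if } x=-1,-2,\ldots,\\ \sum_{j=x+1}^{\infty} v_j & \text{if } x=1,2,\ldots,\\ \max\left\{\sum_{j=1}^{\infty} v_{-j},\ \sum_{j=1}^{\infty} v_j\right\} & \text{if } x=0. \end{cases} $$ For each $\alpha\in[0,1]$, let $F^{(\alpha)}$ be the distribution function given by $$ F^{(\alpha)}(x) = \alpha F_1(x) + (1-\alpha)F_2(x),\qquad x\in\mathbb{R}. $$ Then, for each $\alpha\in[0,1]$, $F^{(\alpha)}$ is infinitely divisible.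
   Context: A sequence $\{u_j : j=1,2,\ldots\}$ of nonnegative real numbers is called log-convex if $u_{j+1}^2 \le u_j\, u_{j+2}$ for every $j\ge 1$ (zero terms are allowed; in particular the identically zero sequence is log-convex). A distribution is nondegenerate if it is not concentrated at a single point. A distribution function $F$ on $\mathbb{R}$ is infinitely divisible if for every positive integer $n$ there is a distribution function $F_n$ on $\mathbb{R}$ whose $n$-fold convolution with itself equals $F$. *)

(* Defs.v *)
From mathcomp Require Import all_boot all_order all_algebra.
From mathcomp Require Import all_classical all_reals all_analysis.

Set Implicit Arguments.
Unset Strict Implicit.
Unset Printing Implicit Defensive.

Import Order.TTheory GRing.Theory Num.Theory.
Import numFieldNormedType.Exports.

Local Open Scope classical_set_scope.
Local Open Scope ring_scope.

(* The sequence is u 1, u 2, ...; the value u 0 is not used. *)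
Definition log_convex (R : realType) (u : nat -> R) : Prop :=
  forall j : nat, (0 < j)%N -> u j.+1 ^+ 2 <= u j * u j.+2.

Definition int_distribution (R : realType) (p : int -> R) : Prop :=
  (forall k, 0 <= p k) /\ \esum_(k in [set: int]) (p k)%:E = 1%E.

Definition nondegenerate_distribution (R : realType) (p : int -> R) : Prop :=
  ~ exists c : int, p c = 1.

Definition degenerate_df (R : realType) (c : R) (x : R) : R :=
  fine (\d_c `]-oo, x]).

Definition int_df (R : realType) (p : int -> R) (x : R) : R :=
  fine (\esum_(k in [set k : int | k%:~R <= x]) (p k)%:E).

(* A distribution function on R is a term of type [cumulativeBounded 0 1]:
   nondecreasing, right-continuous, with limits 0 at -oo and 1 at +oo. *)

(* (F * G)(x) is the Lebesgue-Stieltjes integral of F(x - y) dG(y). *)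
Definition df_conv (R : realType) (F : R -> R)
    (G : cumulativeBounded (0 : R) (1 : R)) (x : R) : R :=
  \int[lebesgue_stieltjes_measure G]_y F (x - y).

(* For n >= 1; in particular [df_nconv G 1] is G itself. *)
Definition df_nconv (R : realType) (G : cumulativeBounded (0 : R) (1 : R))
    (n : nat) : R -> R :=
  iter n.-1 (fun F => df_conv F G) G.

(* The case n = 1 forces F to be a distribution function. *)
Definition infinitely_divisible (R : realType) (F : R -> R) : Prop :=
  forall n : nat, (0 < n)%N ->
    exists G : cumulativeBounded (0 : R) (1 : R),
      forall x : R, df_nconv G n x = F x.

(* Main.v *)
Require Import Defs.
From HB Require Import structures.
From mathcomp Require Import all_boot all_order all_algebra.
From mathcomp Require Import all_classical all_reals all_analysis.
From mathcomp Require Import measurable_realfun.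
From mathcomp Require Import ring lra zify.

(** Let q be the mixture; it is again a distribution on the integers.  Its two
    sides k |-> q k and k |-> q (- k), k >= 0, are summable, with log-convex
    nonnegative differences: away from 0 these differences are multiples of the
    entries of v, and both the maximum taken at 0 and the atom of weight alpha
    only raise the first difference, which keeps log-convexity.  This shape
    ([profile]) is all that the proof uses.

    The core is a Wiener-Hopf factorization ([wiener_hopf]), in terms of
    generating functions q(z) = e(z) u(1/z), where each of the sequences e and u
    on the naturals is a renewal sequence, that is, has the form
    c / (1 - b(z)) with c > 0 and b_1, b_2, ... >= 0.

    The first factor comes from sweeping the unit mass at 0 onto the positive
    integers: one looks for b_j >= 0 with q x = sum_{j >= 1} b_j q (x - j) for all
    x >= 1 ([sweep_limit]).  Sweeping onto {1, ..., N} is a finite linear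
    problem, solved by the Levinson recursion, and the point is the sign of the
    solution.  It rests on a maximum principle ([gap_positive]): if a solution
    had a zero weight at s followed by a positive weight at s + 1, then the
    drops of the residual at s - 1 and at s could not both be compatible with a
    vanishing residual, because the ratios of consecutive differences of q are
    monotone.

    Given b, put u_k = q (- k) - sum_j b_j q (- k - j) for k >= 0, so that
    q = b * q + u.  The sum of the b_j is less than 1, hence q = e * u with
    e = 1 / (1 - b), and
      u_k = (1 - sum_j b_j) q (- k) + sum_j b_j (q (- k) - q (- k - j)),
    where the last bracket is a sum of j consecutive differences.  Sums of
    log-convex sequences are log-convex, so u is log-convex
    ([logconvex_overshoot]); it is here, and in the maximum principle, that
    log-convexity of the differences, rather than of q alone, is essential.  By the theorem of Kaluza a log-convex
    sequence is a renewal sequence ([logconvex_renewal]), which gives the second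
    factor.

    Finally c / (1 - b(z)) has an n-th root with nonnegative coefficients, since
    its logarithmic derivative has nonnegative coefficients ([renewal_root]).
    The product of the roots of e(z) and u(1/z) is an n-th convolution root of
    q, and convolution of distributions on the integers is convolution of their
    distribution functions ([df_conv_lattice]). *)

Import Order.TTheory GRing.Theory Num.Theory.
Import numFieldNormedType.Exports.

Local Open Scope classical_set_scope.
Local Open Scope ring_scope.

Set Implicit Arguments.
Unset Strict Implicit.
Unset Printing Implicit Defensive.

(** * Log-convex sequences and sweeping onto an interval *)

Definition logconvex (R : realType) (u : nat -> R) : Prop :=
  forall k, u k.+1 ^+ 2 <= u k * u k.+2.

Definition drop_of (R : realType) (a : nat -> R) (k : nat) : R := a k - a k.+1.

Definition right_part (R : realType) (q : int -> R) (k : nat) : R := q k%:Z.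

Definition reflect_int (R : realType) (q : int -> R) (x : int) : R := q (- x).

(** The strict form of the shape [profile] below.  Strictness makes all sweeping
    weights positive, so that the Levinson recursion never meets a boundary
    case; the general case follows by perturbation. *)
Record strict_profile (R : realType) (a : nat -> R) : Prop := StrictProfile {
  strict_gt0 : forall k, 0 < a k;
  strict_drop_gt0 : forall k, 0 < drop_of a k;
  strict_drop_dec : forall k, drop_of a k.+1 < drop_of a k;
  strict_drop_logconvex : logconvex (drop_of a);
  strict_logconvex : logconvex a;
  strict_origin : forall k, (0 < k)%N -> a 1%N * a k < a 0%N * a k.+1 }.

(** The potential at x of the unit mass at 0 minus the masses w_1, ..., w_M
    placed at 1, ..., M, for the kernel (x, y) |-> q (x - y). *)
Definition residual (R : realType) (q : int -> R) (w : nat -> R) (M : nat)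
    (x : int) : R :=
  q x - \sum_(1 <= j < M.+1) w j * q (x - j%:Z).

Definition sweeps (R : realType) (q : int -> R) (w : nat -> R) (N : nat) : Prop :=
  forall x, (0 < x <= N)%N -> residual q w N x%:Z = 0.

(** The ratios u_{i+1} / u_i are nondecreasing; the product form also covers
    sequences with zero terms. *)
Lemma logconvex_cross (R : realType) (u : nat -> R) :
  (forall k, 0 <= u k) -> logconvex u ->
  forall i j, (i <= j)%N -> u i.+1 * u j <= u i * u j.+1.
Proof.
move=> u0 lu i j; elim: j => [|j IH]; first by rewrite leqn0 => /eqP ->; rewrite mulrC.
rewrite leq_eqVlt => /orP[/eqP ->|]; first by rewrite mulrC.
rewrite ltnS => /IH {}IH; have [->|uj1] := eqVneq (u j.+1) 0.
  by rewrite mulr0 mulr_ge0.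
have uj1p : 0 < u j.+1 by rewrite lt_neqAle eq_sym uj1 u0.
have ujp : 0 < u j.
  rewrite lt_neqAle eq_sym u0 andbT; apply: contraTneq (lu j) => ->.
  by rewrite mul0r -ltNge exprn_gt0.
have := lu j; have := u0 i => ui luj.
rewrite -(ler_pM2l ujp).
have := ler_wpM2r (ltW uj1p) IH; have := ler_wpM2l ui luj; nra.
Qed.

Section Sweep.
Context {R : realType}.
Implicit Types (q : int -> R) (w g : nat -> R).

Definition int_drop q (y : int) : R := q y - q (y + 1).

Lemma int_drop_right q (k : nat) : int_drop q k%:Z = drop_of (right_part q) k.
Proof. by rewrite /int_drop /drop_of /right_part -addn1 PoszD. Qed.

Lemma int_drop_left q (k : nat) :
  int_drop q (- k%:Z - 1) = - drop_of (right_part (reflect_int q)) k.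
Proof.
rewrite /int_drop /drop_of /right_part /reflect_int opprB; congr (q _ - q _); lia.
Qed.

Lemma residual_drop q g M x :
  residual q g M x - residual q g M (x + 1) =
  int_drop q x - \sum_(1 <= j < M.+1) g j * int_drop q (x - j%:Z).
Proof.
rewrite /residual /int_drop.
have -> : \sum_(1 <= j < M.+1) g j * (q (x - j%:Z) - q (x - j%:Z + 1)) =
  \sum_(1 <= j < M.+1) g j * q (x - j%:Z)
  - \sum_(1 <= j < M.+1) g j * q (x + 1 - j%:Z).
  rewrite -sumrB; apply: eq_bigr => j _; rewrite mulrBr.
  by have -> : x - j%:Z + 1 = x + 1 - j%:Z by lia.
ring.
Qed.

(** The maximum principle behind the positivity of sweeping weights.  Let D be
    the drop of q and suppose g_s = 0 < g_{s+1}.  The drop of the residual at x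
    is D(x) - sum_j g_j D(x - j); it vanishes at s - 1 and is at most 0 at s.
    Cross-multiplying these two expressions by D(s) and D(s - 1) gives terms
    that compare in the same direction for every j: for j < s because D is
    log-convex on the right, for j > s because D is positive and decreasing on
    the right, and negative and decreasing on the left.  As the comparison is
    strict at j = s + 1, this is a contradiction.  For s = 1, where the residual
    at s - 1 = 0 need not vanish, all terms of the drop at 1 have the wrong
    sign. *)
Lemma gap_positive q g M : strict_profile (right_part q) ->
  strict_profile (right_part (reflect_int q)) ->
  (forall j, (0 < j <= M)%N -> 0 <= g j) ->
  (forall x, (0 < x < M)%N -> residual q g M x%:Z = 0) ->
  0 <= residual q g M M%:Z -> 0 < g M ->
  forall s, (0 < s <= M)%N -> 0 < g s.
Proof.
move=> sr sl g_ge0 res0 resM gM.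
have gap_step s : (0 < s < M)%N -> 0 < g s.+1 -> 0 < g s.
  move=> /andP[s0 sM] gs1; rewrite lt_neqAle g_ge0 ?s0 1?ltnW// andbT eq_sym.
  apply/eqP => gs0.
  have ds : int_drop q s%:Z - \sum_(1 <= j < M.+1) g j * int_drop q (s%:Z - j%:Z) <= 0.
    rewrite -residual_drop res0 ?s0// sub0r oppr_le0.
    have -> : s%:Z + 1 = s.+1%:Z by lia.
    move: sM; rewrite leq_eqVlt => /orP[/eqP ->//|sM].
    by rewrite res0.
  have Dpos k : 0 < int_drop q k%:Z by rewrite int_drop_right strict_drop_gt0.
  have Dneg k : int_drop q (- k%:Z - 1) < 0 by rewrite int_drop_left oppr_lt0 strict_drop_gt0.
  (* From here on the zero weight is at s + 1. *)
  case: s => [//|s] in s0 sM gs1 gs0 ds *.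
  have termn j : (s.+1 < j)%N ->
      int_drop q s%:Z * int_drop q (s.+1%:Z - j%:Z) < int_drop q s.+1%:Z * int_drop q (s%:Z - j%:Z).
    move=> js; have -> : s.+1%:Z - j%:Z = - (j - s.+2)%N%:Z - 1 by lia.
    have -> : s%:Z - j%:Z = - (j - s.+2).+1%:Z - 1 by lia.
    rewrite !int_drop_left !int_drop_right !mulrN ltrN2.
    by rewrite ltr_pM ?ltW ?strict_drop_gt0 ?strict_drop_dec.
  have term j : (0 < j <= M)%N ->
      int_drop q s%:Z * (g j * int_drop q (s.+1%:Z - j%:Z)) <=
      int_drop q s.+1%:Z * (g j * int_drop q (s%:Z - j%:Z)).
    move=> jM; have gj := g_ge0 j jM; rewrite mulrCA [leRHS]mulrCA.
    case: (ltngtP j s.+1) => [js|js|->].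
    - apply: ler_wpM2l => //.
      have -> : s.+1%:Z - j%:Z = (s - j).+1%:Z by lia.
      have -> : s%:Z - j%:Z = (s - j)%N%:Z by lia.
      rewrite !int_drop_right mulrC [leRHS]mulrC.
      apply: logconvex_cross => [k||]; last by rewrite leq_subr.
        by rewrite ltW// strict_drop_gt0.
      exact: strict_drop_logconvex.
    - by apply: ler_wpM2l => //; rewrite ltW// termn.
    - by rewrite gs0 !mul0r.
  (* The residual at 0 is not known to vanish, so a zero weight at 1 is apart. *)
  case: s => [|s] in s0 sM gs1 gs0 ds termn term *.
    have : 0 < int_drop q 1%:Z - \sum_(1 <= j < M.+1) g j * int_drop q (1%:Z - j%:Z).
      rewrite subr_gt0; apply: le_lt_trans (Dpos 1%N).
      rewrite big_nat; apply: sumr_le0 => j /andP[j1 jM].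
      move: j1; rewrite leq_eqVlt => /orP[/eqP <-|j1]; first by rewrite gs0 mul0r.
      apply: mulr_ge0_le0; first by rewrite g_ge0// (ltnW j1).
      have -> : 1%:Z - j%:Z = - (j - 2)%N%:Z - 1 by lia.
      exact/ltW.
    by rewrite lt_neqAle leNgt; case: ltgtP ds.
  have d0 : int_drop q s.+1%:Z - \sum_(1 <= j < M.+1) g j * int_drop q (s.+1%:Z - j%:Z) = 0.
    rewrite -residual_drop res0 ?(ltnW sM)//.
    have -> : s.+1%:Z + 1 = s.+2%:Z by lia.
    by rewrite res0 ?sM// subr0.
  have : int_drop q s.+1%:Z * (\sum_(1 <= j < M.+1) g j * int_drop q (s.+2%:Z - j%:Z)) <
    int_drop q s.+2%:Z * (\sum_(1 <= j < M.+1) g j * int_drop q (s.+1%:Z - j%:Z)).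
    have s3 : s.+3 \in index_iota 1 M.+1 by rewrite mem_index_iota.
    rewrite !(bigD1_seq _ s3 (iota_uniq _ _))/= mulrDr [ltRHS]mulrDr ltr_leD//.
      by rewrite mulrCA [ltRHS]mulrCA ltr_pM2l// termn.
    rewrite !mulr_sumr big_seq_cond [leRHS]big_seq_cond.
    apply: ler_sum => j /andP[+ _]; rewrite mem_index_iota => jM.
    exact: term.
  move/subr0_eq: d0 => <-; move: ds.
  set S := \sum_(_ <= _ < _) _ => ds; rewrite mulrC ltr_pM2r//.
  by rewrite ltNge -subr_ge0 -oppr_le0 opprB ds.
move=> s /andP[s0 sM]; rewrite -(subKn sM); have : (M - s < M)%N by lia.
elim: (M - s)%N => [|i IH] iM; first by rewrite subn0.
apply: gap_step; first by lia.
by rewrite subnSK ?IH// ltnW.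
Qed.

Lemma reflect_intK q : reflect_int (reflect_int q) = q.
Proof. by apply/funext => x; rewrite /reflect_int opprK. Qed.

(** For the value of t that makes the residual vanish at N + 1, this is the
    update of the Levinson recursion for Toeplitz systems: g solves the problem
    of size N for q, and h the one for the reflected kernel. *)
Definition levinson g h N (t : R) (j : nat) : R :=
  if j == N.+1 then t else g j - t * h (N.+1 - j)%N.

Lemma residual_levinson q g h N t (x : int) :
  residual q (levinson g h N t) N.+1 x =
  residual q g N x - t * residual (reflect_int q) h N (N.+1%:Z - x).
Proof.
rewrite /residual big_nat_recr//= {2}/levinson eqxx.
rewrite [X in _ - (X + _)](_ : _ = \sum_(1 <= j < N.+1) g j * q (x - j%:Z)
   - t * \sum_(1 <= j < N.+1) h j * reflect_int q (N.+1%:Z - x - j%:Z)); last first.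
  rewrite [X in _ = _ - _ * X]big_nat_rev/= mulr_sumr -sumrB.
  apply: eq_big_nat => j /andP[j1 jN]; rewrite /levinson ltn_eqF//.
  rewrite mulrBl mulrA add1n subSS; congr (_ - _ * q _); lia.
have -> : reflect_int q (N.+1%:Z - x) = q (x - N.+1%:Z) by rewrite /reflect_int opprB.
ring.
Qed.

(** Dividing the residual by q turns each term into a ratio q (x - j) / q x,
    which is nonincreasing in x by log-convexity, strictly at x = N for j = N;
    the residual vanishes at N, so it is positive at N + 1. *)
Lemma residual_next_gt0 q g N : strict_profile (right_part q) ->
  (forall j, (0 < j <= N)%N -> 0 < g j) -> sweeps q g N ->
  0 < residual q g N N.+1%:Z.
Proof.
move=> sr g0 sw; case: N => [|N] in g0 sw *.
  by rewrite /residual big_geq// subr0; exact: (strict_gt0 sr 1).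
have a0 := strict_gt0 sr; rewrite -(pmulr_lgt0 _ (a0 N.+1)).
have /eqP := sw N.+1 ltac:(by rewrite leqnn).
rewrite /residual subr_eq0 => /eqP E.
rewrite mulrBl {1}/right_part E mulr_suml mulr_sumr subr_gt0.
rewrite big_nat_recr//= [ltRHS]big_nat_recr//= ler_ltD//.
  apply: ler_sum_nat => j /andP[j1 jN].
  rewrite -mulrA [leRHS]mulrCA ler_wpM2l//; first by rewrite ltW// g0// j1 ltnW.
  have -> : N.+2%:Z - j%:Z = (N.+1 - j).+1%:Z by lia.
  have -> : N.+1%:Z - j%:Z = (N.+1 - j)%N%:Z by lia.
  rewrite [leRHS]mulrC; apply: (logconvex_cross (u := right_part q)) => [k||].
  - exact/ltW.
  - exact: strict_logconvex.
  - exact: leq_subr.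
rewrite -mulrA [ltRHS]mulrCA ltr_pM2l ?g0 ?leqnn//.
have -> : N.+2%:Z - N.+1%:Z = 1%:Z by lia.
rewrite subrr [ltRHS]mulrC; exact: (strict_origin sr).
Qed.

(** The residual vanishes at 1, and its drop from 0 to 1 only has nonnegative
    terms. *)
Lemma residual_origin_gt0 q g N : strict_profile (right_part q) ->
  strict_profile (right_part (reflect_int q)) ->
  (forall j, (0 < j <= N)%N -> 0 < g j) -> sweeps q g N ->
  0 < residual q g N 0.
Proof.
move=> sr sl g0 sw; case: N => [|N] in g0 sw *.
  by rewrite /residual big_geq// subr0; exact: (strict_gt0 sr 0).
have := residual_drop q g N.+1 0; rewrite add0r (sw 1%N)// subr0 => ->.
rewrite (int_drop_right q 0).
apply: ltr_wpDr; last exact: (strict_drop_gt0 sr).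
rewrite oppr_ge0 big_nat; apply: sumr_le0 => j /andP[j1 jN].
apply: mulr_ge0_le0; first by rewrite ltW// g0// j1.
have -> : 0 - j%:Z = - j.-1%:Z - 1 by lia.
by rewrite int_drop_left oppr_le0 ltW// strict_drop_gt0.
Qed.

(** Increase t from 0, where the weights at 1, ..., N are positive, to the value
    f / k at which the residual at N + 1 vanishes.  If some weight became nonpositive on
    the way, then at the first t at which a weight is zero [gap_positive] would
    apply and contradict that zero. *)
Lemma sweep_step q g h N : strict_profile (right_part q) ->
  strict_profile (right_part (reflect_int q)) ->
  (forall j, (0 < j <= N)%N -> 0 < g j) -> sweeps q g N ->
  (forall j, (0 < j <= N)%N -> 0 < h j) -> sweeps (reflect_int q) h N ->
  exists2 g', (forall j, (0 < j <= N.+1)%N -> 0 < g' j) & sweeps q g' N.+1.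
Proof.
move=> sr sl g0 swg h0 swh.
have f0 := residual_next_gt0 sr g0 swg.
have k0 : 0 < residual (reflect_int q) h N 0.
  by apply: residual_origin_gt0 => //; rewrite reflect_intK.
set f := residual q g N _ in f0; set k := residual _ h N 0 in k0.
have lev0 t x : (0 < x < N.+1)%N ->
    residual q (levinson g h N t) N.+1 x%:Z = 0.
  move=> xN; rewrite residual_levinson swg//.
  have -> : N.+1%:Z - x%:Z = (N.+1 - x)%N%:Z by lia.
  by rewrite swh ?mulr0 ?subr0//; lia.
have levN t : residual q (levinson g h N t) N.+1 N.+1%:Z = f - t * k.
  by rewrite residual_levinson subrr.
exists (levinson g h N (f / k)); last first.
  move=> x /andP[x0]; rewrite leq_eqVlt => /orP[/eqP ->|xN].
    by rewrite levN divfK ?subrr// gt_eqF.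
  by rewrite lev0// x0.
move=> j /andP[j0]; rewrite leq_eqVlt => /orP[/eqP ->|jN].
  by rewrite /levinson eqxx divr_gt0.
rewrite ltNge; apply/negP => levj.
(* The weight at i + 1 vanishes at t = r i; the smallest r i is the first zero. *)
pose r (i : 'I_N) := g i.+1 / h (N - i)%N.
have hi (i : 'I_N) : 0 < h (N - i)%N.
  by apply: h0; rewrite subn_gt0 ltn_ord leq_subr.
have ri (i : 'I_N) : 0 < r i by rewrite divr_gt0// g0//= ltn_ord.
have jN' : (j.-1 < N)%N by lia.
case: (@arg_minP _ _ _ (Ordinal jN') xpredT r isT) => i _ rmin.
have rc : r i <= f / k.
  apply: le_trans (rmin (Ordinal jN') isT) _.
  rewrite /r/= ler_pdivrMr ?(hi (Ordinal jN'))// prednK//.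
  move: levj; rewrite /levinson ltn_eqF// subr_le0.
  by have -> : (N.+1 - j = N - j.-1)%N by lia.
suff : 0 < levinson g h N (r i) i.+1.
  by rewrite /levinson ltn_eqF ?ltnS ?ltn_ord// subSS divfK ?gt_eqF// subrr ltxx.
apply: (@gap_positive q _ N.+1 sr sl) => [l|x||| ].
- move=> /andP[l0]; rewrite leq_eqVlt => /orP[/eqP ->|lN].
    by rewrite /levinson eqxx ltW.
  rewrite /levinson ltn_eqF// subr_ge0.
  have lN' : (l.-1 < N)%N by lia.
  have := rmin (Ordinal lN') isT.
  rewrite {2}/r ler_pdivlMr ?(hi (Ordinal lN'))//= prednK//.
  by have -> : (N.+1 - l = N - l.-1)%N by lia.
- exact: lev0.
- by rewrite levN subr_ge0 -ler_pdivlMr.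
- by rewrite /levinson eqxx.
- exact: leq_trans (ltn_ord i) (leqnSn N).
Qed.

Lemma strict_sweep q N : strict_profile (right_part q) ->
  strict_profile (right_part (reflect_int q)) ->
  exists2 g, (forall j, (0 < j <= N)%N -> 0 < g j) & sweeps q g N.
Proof.
elim: N q => [|N IH] q sr sl.
  by exists (fun=> 0) => j; rewrite lt0n leqn0 andNb.
have [g g0 swg] := IH _ sr sl.
have [|h h0 swh] := IH _ sl; first by rewrite reflect_intK.
exact: sweep_step g0 swg h0 swh.
Qed.

End Sweep.

(** * Summable sequences with log-convex differences *)

Section LogConvex.
Context {R : realType}.
Implicit Types (u v a : nat -> R).

Lemma logconvexD u v : (forall k, 0 <= u k) -> (forall k, 0 <= v k) ->
  logconvex u -> logconvex v -> logconvex (fun k => u k + v k).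
Proof.
move=> u0 v0 lu lv k.
have cross : 2 * (u k.+1 * v k.+1) <= u k * v k.+2 + u k.+2 * v k.
  rewrite -ler_sqr ?nnegrE; last 2 first.
  - by rewrite !mulr_ge0.
  - by rewrite addr_ge0// mulr_ge0.
  apply: (@le_trans _ _ (4 * (u k * u k.+2) * (v k * v k.+2))).
    have -> : (2 * (u k.+1 * v k.+1)) ^+ 2 = 4 * (u k.+1 ^+ 2 * v k.+1 ^+ 2) by ring.
    by rewrite -mulrA ler_pM2l// ler_pM ?sqr_ge0.
  rewrite -subr_ge0.
  have -> : (u k * v k.+2 + u k.+2 * v k) ^+ 2 - 4 * (u k * u k.+2) * (v k * v k.+2)
    = (u k * v k.+2 - u k.+2 * v k) ^+ 2 by ring.
  exact: sqr_ge0.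
have := lu k; have := lv k; lra.
Qed.

Lemma logconvexZ c u : logconvex u -> logconvex (fun k => c * u k).
Proof.
move=> lu k; have -> : c * u k * (c * u k.+2) = c ^+ 2 * (u k * u k.+2) by ring.
by rewrite exprMn ler_wpM2l// sqr_ge0.
Qed.

(** One increase would force, by monotone ratios, increases ever after. *)
Lemma logconvex_nonincreasing u : (forall k, 0 <= u k) -> logconvex u ->
  u @ \oo --> 0 -> forall k, u k.+1 <= u k.
Proof.
move=> u0 lu ucvg k; rewrite leNgt; apply/negP => uk.
have ukp : 0 < u k.
  rewrite lt_neqAle u0 andbT; apply/eqP => uk0.
  have := lu k; rewrite -uk0 mul0r leNgt exprn_gt0//.
  exact: le_lt_trans uk.
have grow j : (u k.+1 <= u (k.+1 + j)%N).
  elim: j => [|j IH]; first by rewrite addn0.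
  rewrite addnS; apply: le_trans IH _.
  have := logconvex_cross u0 lu (i := k) (j := (k.+1 + j)%N).
  rewrite addSn -ltnS leqW ?leq_addr// => /(_ isT) h.
  rewrite -(ler_pM2l ukp); apply: le_trans h.
  by rewrite ler_wpM2r// ltW.
suff : u k.+1 <= 0 by rewrite leNgt (le_lt_trans _ uk).
apply: (cvgr_to_ge ucvg); exists k.+1 => // n /= kn.
by rewrite -(subnKC kn).
Qed.

(** With v = [drop_of a], log-convexity of a at k amounts to
    v_{k+1} a_{k+1} <= v_k a_{k+2}.  As a vanishes at infinity, both sides are
    sums of products of two entries of v, compared by [logconvex_cross]. *)
Lemma logconvex_of_drop a : (forall k, 0 <= a k) -> (forall k, 0 <= drop_of a k) ->
  logconvex (drop_of a) -> a @ \oo --> 0 -> logconvex a.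
Proof.
move=> a0 d0 ld acvg k.
set v := drop_of a in d0 ld.
have ineq m : v k.+1 * (a k.+1 - a (k.+1 + m)%N) <= v k * (a k.+2 - a (k.+2 + m)%N).
  elim: m => [|m IH]; first by rewrite !addn0 !subrr !mulr0.
  have := logconvex_cross d0 ld (i := k) (j := (k.+1 + m)%N).
  rewrite addSn -ltnS leqW ?leq_addr// => /(_ isT).
  rewrite -/v /v /drop_of -!addSn !addnS in IH *.
  rewrite /drop_of !addSn in IH *; nra.
have main : v k.+1 * a k.+1 - v k * a k.+2 <= 0.
  have cv : v k.+1 * a (k.+1 + m)%N @[m --> \oo] --> 0.
    rewrite -(mulr0 (v k.+1)); apply: cvgM; first exact: cvg_cst.
    exact: cvg_comp (cvg_addnl k.+1) acvg.
  apply: (cvgr_to_ge cv); apply: nearW => m.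
  have := ineq m; have := mulr_ge0 (d0 k) (a0 (k.+2 + m)%N); lra.
move: main; rewrite /v /drop_of; nra.
Qed.

(** The shape of each side of the distributions under study. *)
Record profile a : Prop := Profile {
  profile_ge0 : forall k, 0 <= a k;
  profile_drop_ge0 : forall k, 0 <= drop_of a k;
  profile_drop_logconvex : logconvex (drop_of a);
  profile_summable : cvgn (series a) }.

Lemma profile_cvg0 a : profile a -> a @ \oo --> 0.
Proof. by move=> /profile_summable; exact: cvg_series_cvg_0. Qed.

Lemma profile_drop_cvg0 a : profile a -> drop_of a @ \oo --> 0.
Proof.
move=> ma; rewrite -(subr0 0); apply: cvgB; first exact: profile_cvg0.
by rewrite (cvg_shiftS a); exact: profile_cvg0.
Qed.

Lemma profile_drop_nonincreasing a : profile a ->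
  forall k, drop_of a k.+1 <= drop_of a k.
Proof.
move=> ma; apply: logconvex_nonincreasing (profile_drop_cvg0 ma).
  exact: profile_drop_ge0.
exact: profile_drop_logconvex.
Qed.

Lemma profile_logconvex a : profile a -> logconvex a.
Proof.
by move=> ma; have [a0 d0 ld _] := ma; apply: logconvex_of_drop => //; exact: profile_cvg0.
Qed.

(** The geometric term makes drops positive and strictly decreasing; the extra
    unit at 0 makes the log-convexity strict at the origin. *)
Definition bump (k : nat) : R := 2^-1 ^+ k + (k == 0)%:R.

Lemma bump_gt0 k : 0 < bump k.
Proof. by rewrite ltr_wpDr// exprn_gt0. Qed.

Lemma drop_bump k : drop_of bump k = 2^-1 ^+ k.+1 + (k == 0)%:R.
Proof. rewrite /drop_of /bump exprS /= addr0; lra. Qed.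

Lemma strict_perturb (eta : R) a : 0 < eta -> profile a ->
  strict_profile (fun k => a k + eta * bump k).
Proof.
move=> eta0 ma.
have dropE k : drop_of (fun k => a k + eta * bump k) k =
    drop_of a k + eta * drop_of bump k by rewrite /drop_of; ring.
have h0 k : 0 < 2^-1 ^+ k :> R by rewrite exprn_gt0.
have db k : 0 < drop_of bump k by rewrite drop_bump ltr_wpDr.
have [a0 d0 ld _] := ma.
have half_lc : logconvex (fun k => eta * 2^-1 ^+ k).
  by apply: logconvexZ => k; rewrite -exprM -exprD muln2 -addnn addSnnS.
have la' : logconvex (fun k => a k + eta * 2^-1 ^+ k).
  apply: logconvexD half_lc => //; last exact: profile_logconvex.
  by move=> k; apply: mulr_ge0; exact: ltW.
split.
- by move=> k; rewrite ltr_wpDl// mulr_gt0// bump_gt0.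
- by move=> k; rewrite dropE ltr_wpDl// mulr_gt0.
- move=> k; rewrite !dropE ler_ltD ?profile_drop_nonincreasing// ltr_pM2l//.
  rewrite !drop_bump addr0 ltr_wpDr//.
  by rewrite exprS gtr_pMl// invf_lt1// ltr1n.
- have -> : drop_of (fun k => a k + eta * bump k) =
      fun k => drop_of a k + eta * drop_of bump k by exact/funext.
  apply: logconvexD => // [k|]; first by apply: mulr_ge0; exact: ltW.
  apply: logconvexZ => k; rewrite !drop_bump addr0.
  case: k => [|k]; rewrite /= ?addr0 !exprS ?expr0; first lra.
  by move: (2^-1 ^+ k) => z; lra.
- move=> k.
  have := la' k; rewrite /bump; case: k => [|k]; rewrite /= ?addr0//.
  move=> /le_trans; apply; apply: ler_wpM2r.
    by rewrite addr_ge0// ltW// mulr_gt0.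
  by rewrite lerD2l ler_pM2l// lerDl.
- move=> [//|k] _.
  have := logconvex_cross (u := fun k => a k + eta * 2^-1 ^+ k) _ la' (leq0n k.+1).
  have a'0 j : 0 < a j + eta * 2^-1 ^+ j by rewrite ltr_wpDl// mulr_gt0.
  rewrite /bump/= !addr0 => /(_ (fun j => ltW (a'0 j)))/le_lt_trans; apply.
  rewrite ltr_pM2r//.
  by rewrite ltrD2l ltr_pM2l// ltrDl.
Qed.

Lemma sum_drop a m n : (m <= n)%N ->
  \sum_(m <= k < n) drop_of a k = a m - a n.
Proof.
move=> mn; rewrite -opprB -telescope_sumr// -sumrN.
by apply: eq_bigr => k _; rewrite opprB.
Qed.

Lemma sum_bump_le m n : \sum_(m <= k < n) bump k <= 4.
Proof.
have [mn|nm] := leqP m n; last by rewrite big_geq// ltnW.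
apply: (@le_trans _ _ (2 * \sum_(m <= k < n) drop_of bump k)).
  rewrite mulr_sumr; apply: ler_sum => k _; rewrite drop_bump /bump exprS.
  have : 0 <= (k == 0%N)%:R :> R by []; lra.
rewrite sum_drop//; have := bump_gt0 n.
suff : bump m <= 2 by lra.
rewrite /bump; case: m {mn} => [|m]; first by rewrite expr0.
rewrite addr0 (@le_trans _ _ 1)//; last by rewrite ler1n.
by rewrite exprn_ile1 ?invr_ge0// invf_le1// ler1n.
Qed.

Lemma drop_ge0_le0 a k : (forall k, 0 <= drop_of a k) -> a k <= a 0%N.
Proof. by move=> d0; rewrite -subr_ge0 -sum_drop//; exact: sumr_ge0. Qed.

Lemma sum_tail_le a m n : (forall k, 0 <= a k) -> cvgn (series a) ->
  \sum_(m <= k < n) a k <= limn (series a) - series a m.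
Proof.
move=> a0 ca; have nds : nondecreasing_seq (series a).
  by apply: (@nondecreasing_series _ a xpredT 0) => k _ _; exact: a0.
have [mn|nm] := leqP m n; last first.
  rewrite big_geq ?(ltnW nm)// subr_ge0.
  exact: (nondecreasing_cvgn_le nds ca).
rewrite lerBrDl /series/= -big_cat_nat//.
exact: (nondecreasing_cvgn_le nds ca).
Qed.

End LogConvex.

(** * Sweeping onto the positive integers *)

Section SweepLimit.
Context {R : realType}.
Implicit Types (q : int -> R) (u : nat -> nat -> R).

(** Convergence along one ultrafilter replaces the extraction of a diagonal
    subsequence. *)
Lemma ultra_limits u : (forall N s, 0 <= u N s <= 1) ->
  exists2 U : set_system nat, UltraFilter U /\ \oo `<=` U &
  exists2 b : nat -> R, forall s, 0 <= b s & forall s, u N s @[N --> U] --> b s.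
Proof.
move=> u01; have [U [ultraU subU]] := ultraFilterLemma (F := \oo) _.
exists U => //.
have /choice[b bP] : forall s, exists b : R, 0 <= b /\ u N s @[N --> U] --> b.
  move=> s.
  have [|b [b01 clb]] := @segment_compact R 0 1 (u N s @[N --> U]) _.
    by apply: (@filterE _ U) => N; rewrite /= in_itv/= u01.
  exists b; split; first by move: b01; rewrite /= in_itv/= => /andP[].
  move=> B bB; have [//|nB] := in_ultra_setVsetC (u^~ s @^-1` B) ultraU.
  by have [y []] := clb (~` B) B nB bB.
by exists b => s; have [] := bP s.
Qed.

Definition perturb q (eta : R) (x : int) : R := q x + eta * bump `|x|%N.

Lemma right_perturb q eta :
  right_part (perturb q eta) = fun k => right_part q k + eta * bump k.
Proof. by apply/funext => k; rewrite /right_part /perturb absz_nat. Qed.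

Lemma reflect_perturb q eta :
  reflect_int (perturb q eta) = perturb (reflect_int q) eta.
Proof. by apply/funext => x; rewrite /reflect_int /perturb abszN. Qed.

Lemma int_right_or_left (P : R -> Prop) q :
  (forall k, P (right_part q k)) -> (forall k, P (right_part (reflect_int q) k)) ->
  forall x, P (q x).
Proof.
move=> Pr Pl [k|k]; first exact: Pr.
by have := Pl k.+1; rewrite /right_part /reflect_int NegzE.
Qed.

(** The term j = s of the sum that represents q s is already g s * q 0, while
    q s <= q 0.  This bound provides the compactness for the passage to the
    limit. *)
Lemma sweep_le1 q g N s : strict_profile (right_part q) ->
  strict_profile (right_part (reflect_int q)) ->
  (forall j, (0 < j <= N)%N -> 0 < g j) -> sweeps q g N -> (0 < s <= N)%N ->
  g s <= 1.
Proof.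
move=> sr sl g0 sw sN.
have q0 x : 0 < q x.
  by apply: (int_right_or_left (P := fun y => 0 < y)); exact: strict_gt0.
have /eqP := sw s sN; rewrite subr_eq0 => /eqP qs.
have : g s * q 0 <= q 0.
  apply: (@le_trans _ _ (q s%:Z)); last first.
    by apply: (@drop_ge0_le0 _ (right_part q)) => k; exact/ltW/strict_drop_gt0.
  rewrite qs (bigD1_seq s) ?iota_uniq ?mem_index_iota ?ltnS//= subrr lerDl.
  rewrite big_seq_cond; apply: sumr_ge0 => j /andP[]; rewrite mem_index_iota ltnS => jN _.
  by rewrite mulr_ge0// ltW// g0.
by rewrite -{2}(mul1r (q 0)) ler_pM2r.
Qed.

Lemma sweep_perturbed q eta N : 0 < eta -> profile (right_part q) ->
  profile (right_part (reflect_int q)) ->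
  exists2 g, forall j, 0 <= g j <= 1 & sweeps (perturb q eta) g N.
Proof.
move=> eta0 mr ml.
have sr : strict_profile (right_part (perturb q eta)).
  by rewrite right_perturb; exact: strict_perturb.
have sl : strict_profile (right_part (reflect_int (perturb q eta))).
  by rewrite reflect_perturb right_perturb; exact: strict_perturb.
have [g g0 sw] := strict_sweep N sr sl.
exists (fun j => if (0 < j <= N)%N then g j else 0) => [j|x xN].
  case: ifPn => jN; last by rewrite lexx ler01.
  by rewrite ltW ?g0//= (sweep_le1 sr sl g0 sw).
rewrite -(sw x xN) /residual; congr (_ - _).
by apply: eq_big_nat => j; rewrite ltnS => ->.
Qed.

(** The weights are limits of the weights for {1, ..., N} and for q perturbed by
    1 / (N + 1) times [bump].  Since weights are at most 1, the terms with j > M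
    contribute at most a tail of the left side of q, uniformly in N, so no mass
    is lost in the limit. *)
Lemma sweep_limit q : profile (right_part q) -> profile (right_part (reflect_int q)) ->
  exists2 b : nat -> R, forall j, 0 <= b j & forall x, (0 < x)%N ->
    \sum_(1 <= j < M.+1) b j * q (x%:Z - j%:Z) @[M --> \oo] --> q x%:Z.
Proof.
move=> mr ml.
have /choice[g gP] : forall N, exists g, (forall j, 0 <= g j <= 1) /\
    sweeps (perturb q (harmonic N)) g N.
  move=> N; have [|g] := @sweep_perturbed q (harmonic N) N _ mr ml.
    by rewrite harmonic_gt0.
  by exists g.
have [U [ultraU subU] [b b0 gb]] := ultra_limits (fun N s => (gP N).1 s).
exists b => // x x0.
pose l := right_part (reflect_int q).
have q0 y : 0 <= q y.
  by apply: (int_right_or_left (P := fun y => 0 <= y)); exact: profile_ge0.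
have harm0 : harmonic N @[N --> U] --> (0 : R).
  by move=> A nA; apply: subU; exact: cvg_harmonic.
have pcvg y : perturb q (harmonic N) y @[N --> U] --> q y.
  rewrite -[X in _ --> X]addr0 -[X in _ --> _ + X](mul0r (bump `|y|%N)).
  by apply: cvgD; [exact: cvg_cst|apply: cvgM => //; exact: cvg_cst].
(* T M bounds the contribution of the weights at j > M. *)
pose T M := limn (series l) - series l (M.+1 - x)%N.
have bound M : (x <= M)%N ->
    q x%:Z - T M <= \sum_(1 <= j < M.+1) b j * q (x%:Z - j%:Z) <= q x%:Z.
  move=> xM.
  pose S N := \sum_(1 <= j < M.+1) g N j * perturb q (harmonic N) (x%:Z - j%:Z).
  have cvgS : S N @[N --> U] --> \sum_(1 <= j < M.+1) b j * q (x%:Z - j%:Z).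
    apply: cvg_big => [|j _]; first exact: add_continuous.
    exact: cvgM.
  have boundN N : (M <= N)%N -> 0 <= perturb q (harmonic N) x%:Z - S N <=
      T M + harmonic N * 4.
    move=> MN; have [g01 /(_ x)] := gP N.
    rewrite x0 (leq_trans xM MN) => /(_ isT)/eqP; rewrite subr_eq0 => /eqP ->.
    rewrite (big_cat_nat (n := M.+1))//= /S addrAC subrr add0r.
    have p0 y : 0 <= perturb q (harmonic N) y.
      by rewrite addr_ge0// mulr_ge0 ?harmonic_ge0// ltW// bump_gt0.
    apply/andP; split.
      by apply: sumr_ge0 => j _; rewrite mulr_ge0//; case/andP: (g01 j).
    apply: (@le_trans _ _ (\sum_(M.+1 <= j < N.+1) perturb q (harmonic N) (x%:Z - j%:Z))).
      apply: ler_sum => j _; rewrite -[leRHS]mul1r ler_wpM2r//.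
      by case/andP: (g01 j).
    rewrite -{1}(subnK (leqW xM)) big_addn.
    rewrite (eq_bigr (fun k => l k + harmonic N * bump k)); last first.
      move=> k _; rewrite /perturb /l /right_part /reflect_int.
      have -> : x%:Z - (k + x)%N%:Z = - k%:Z by lia.
      by rewrite abszN absz_nat.
    rewrite big_split/= -mulr_sumr lerD//.
      by apply: sum_tail_le; [exact: profile_ge0|exact: profile_summable].
    by rewrite ler_wpM2l ?harmonic_ge0// sum_bump_le.
  have evN : \forall N \near U, (M <= N)%N by apply: subU; exact: nbhs_infty_ge.
  have cvgd : perturb q (harmonic N) x%:Z - S N @[N --> U] -->
      q x%:Z - \sum_(1 <= j < M.+1) b j * q (x%:Z - j%:Z) by exact: cvgB.
  have cvgt : perturb q (harmonic N) x%:Z - S N - harmonic N * 4 @[N --> U] -->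
      q x%:Z - \sum_(1 <= j < M.+1) b j * q (x%:Z - j%:Z) - 0 * 4.
    by apply: cvgB => //; apply: cvgM => //; exact: cvg_cst.
  have lo := cvgr_to_ge cvgd (b := 0); have hi := cvgr_to_le cvgt (b := T M).
  rewrite lerBlDr -lerBlDl; apply/andP; split.
    rewrite -[leLHS]subr0 -[X in _ - X](mul0r 4); apply: hi.
    by apply: filterS evN => N /boundN/andP[_ ?]; rewrite lerBlDr.
  rewrite -subr_ge0; apply: lo.
  by apply: filterS evN => N /boundN/andP[].
apply: (@squeeze_cvgr _ _ _ _ (fun M => q x%:Z - T M) (fun=> q x%:Z)).
- by near=> M; apply: bound; near: M; exact: nbhs_infty_ge.
- rewrite -[X in _ --> X]subr0; apply: cvgB; first exact: cvg_cst.
  rewrite -(subrr (limn (series l))); apply: cvgB; first exact: cvg_cst.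
  rewrite -(cvg_shiftn x) /=; have := profile_summable ml; rewrite -(cvg_shiftS (series l)).
  by apply: cvg_trans; apply: near_eq_cvg; apply: nearW => M /=; congr (series l _); lia.
- exact: cvg_cst.
Unshelve. all: by end_near.
Qed.

End SweepLimit.

(** * Renewal sequences and their roots *)

(** Defines sequences by equations that express each term by the previous ones,
    given as a functional F on whole sequences. *)
Lemma strong_recursion (T : Type) (F : (nat -> T) -> nat -> T) (t0 : T) :
  (forall f g n, (forall i, (i < n)%N -> f i = g i) -> F f n = F g n) ->
  exists f, forall n, f n = F f n.
Proof.
move=> Fext; pose G k := iter k F (fun=> t0).
have stable n : forall m, (n < m)%N -> G m n = G n.+1 n.
  elim/ltn_ind: n => n IH [//|m] nm.
  apply: (Fext (G m) (G n)) => i ni; rewrite (IH i ni m) ?(IH i ni n)//.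
  exact: leq_trans ni nm.
exists (fun n => G n.+1 n) => n.
by apply: (Fext (G n)) => i ni; rewrite stable.
Qed.

Section Renewal.
Context {R : realType}.
Implicit Types (a b e u : nat -> R).

(** In generating functions, e(z) (1 - b(z)) = e_0, with b_0 read as 0. *)
Definition renewal e b : Prop := forall k, (0 < k)%N ->
  e k = \sum_(1 <= j < k.+1) b j * e (k - j)%N.

Lemma renewal_exists b : exists2 e, e 0%N = 1 & renewal e b.
Proof.
have [|e eE] := @strong_recursion R (fun e k => if k is 0 then 1 else
    \sum_(1 <= j < k.+1) b j * e (k - j)%N) 0.
  move=> f g [//|n] fg; apply: eq_big_nat => j /andP[j0 _].
  by rewrite fg// ltn_subrL j0.
by exists e => [|[//|k] _]; rewrite eE.
Qed.

Lemma renewal_ge0 e b : (forall j, 0 <= b j) -> 0 <= e 0%N -> renewal e b ->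
  forall k, 0 <= e k.
Proof.
move=> b0 e0 re; elim/ltn_ind => -[//|k] IH.
rewrite re// big_nat; apply: sumr_ge0 => j /andP[j0 _].
by rewrite mulr_ge0// IH// ltn_subrL j0.
Qed.

Lemma renewal_le1 e b : (forall j, 0 <= b j) ->
  (forall M, \sum_(1 <= j < M.+1) b j <= 1) -> e 0%N = 1 -> renewal e b ->
  forall k, e k <= 1.
Proof.
move=> b0 b1 e0 re; elim/ltn_ind => -[|k] IH; first by rewrite e0.
rewrite re//; apply: le_trans (b1 k.+1); apply: ler_sum_nat => j /andP[j0 _].
by rewrite -[leRHS]mulr1 ler_wpM2l// IH// ltn_subrL j0.
Qed.

Definition zero_head b (k : nat) : R := if k is 0 then 0 else b k.

Lemma zero_head_ge0 b : (forall k, 0 <= b k) -> forall k, 0 <= zero_head b k.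
Proof. by move=> b0 [|k] /=. Qed.

(** Kaluza's theorem.  Multiplying the renewal equation at k by u_{k+1} / u_k
    and subtracting it from the definition of b_{k+1} leaves a sum of terms
    b_j (u_{k-j} u_{k+1} / u_k - u_{k+1-j}), nonnegative by monotone ratios. *)
Lemma logconvex_renewal u : (forall k, 0 <= u k) -> 0 < u 0%N -> logconvex u ->
  exists2 b, (forall j, 0 <= b j) & renewal u b.
Proof.
move=> u0 u0p lu; have [u1|u1] := eqVneq (u 1%N) 0.
  have uS k : u k.+1 = 0.
    elim: k => [//|k IH]; apply/eqP; rewrite -sqrf_eq0 eq_le sqr_ge0 andbT.
    by have := lu k.+1; rewrite IH mul0r.
  exists (fun=> 0) => // -[//|k] _.
  by rewrite uS big1// => j _; rewrite mul0r.
have up k : 0 < u k.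
  have : 0 < u k /\ 0 < u k.+1.
    elim: k => [|k [_ IH]]; first by rewrite u0p lt_neqAle u0 eq_sym u1.
    split=> //; rewrite lt_neqAle u0 andbT eq_sym; apply/eqP => uk2.
    by have := lu k; rewrite uk2 mulr0 leNgt exprn_gt0.
  by case.
have [|b bE] := @strong_recursion R (fun b k =>
    (u k - \sum_(1 <= j < k) b j * u (k - j)%N) / u 0%N) 0.
  move=> f g n fg; congr ((_ - _) / _); apply: eq_big_nat => j /andP[_ jn].
  by rewrite fg.
have ren : renewal u b.
  move=> k k0; rewrite big_nat_recr//= subnn bE divfK ?gt_eqF//; ring.
exists (zero_head b); last first.
  by move=> k k0; rewrite {1}ren//; apply: eq_big_nat => -[].
move=> [//|j] /=; elim/ltn_ind: j => -[|k] IH.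
  by rewrite bE big_geq// subr0 divr_ge0.
rewrite bE divr_ge0// -(pmulr_rge0 _ (up k.+1)) mulrBr subr_ge0 mulr_sumr.
rewrite mulrC [X in _ * X]ren// mulr_sumr; apply: ler_sum_nat => j /andP[j0 jk].
rewrite mulrCA [leRHS]mulrCA ler_wpM2l//.
  by case: j j0 jk => // j _; rewrite ltnS => /IH.
have -> : (k.+2 - j = (k.+1 - j).+1)%N by lia.
rewrite mulrC [leRHS]mulrC.
by apply: logconvex_cross => //; exact: leq_subr.
Qed.

Definition cauchy_product a b (k : nat) : R :=
  \sum_(i < k.+1) a i * b (k - i)%N.

(** Congruence of power series modulo X^N. *)
Definition eq_below N (p r : {poly R}) : Prop := forall k, (k < N)%N -> p`_k = r`_k.

Definition truncation N a : {poly R} := \poly_(i < N) a i.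

Lemma eq_belowM N p p' r r' : eq_below N p p' -> eq_below N r r' ->
  eq_below N (p * r) (p' * r').
Proof.
move=> pp rr k kN; rewrite !coefM; apply: eq_bigr => i _.
have ik : (i <= k)%N by rewrite -ltnS.
by rewrite pp ?rr// ?(leq_ltn_trans _ kN)// leq_subr.
Qed.

Lemma coef_truncation N a k : (k < N)%N -> (truncation N a)`_k = a k.
Proof. by rewrite coef_poly => ->. Qed.

Lemma coef_truncationM N a b k : (k < N)%N ->
  (truncation N a * truncation N b)`_k = cauchy_product a b k.
Proof.
move=> kN; rewrite coefM; apply: eq_bigr => i _.
have ik : (i <= k)%N by rewrite -ltnS.
by rewrite !coef_truncation// (leq_ltn_trans _ kN)// leq_subr.
Qed.

Lemma coef_truncationX N a m k : (k < N)%N ->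
  (truncation N a ^+ m.+1)`_k = iter m (fun f => cauchy_product f a) a k.
Proof.
elim: m k => [|m IH] k kN; first by rewrite expr1 coef_truncation.
rewrite exprSr coefM iterS; apply: eq_bigr => i _.
have ik : (i <= k)%N by rewrite -ltnS.
by rewrite IH ?coef_truncation// (leq_ltn_trans _ kN)// leq_subr.
Qed.

Lemma coefX_deriv (p : {poly R}) k : ('X * p^`())`_k = p`_k *+ k.
Proof. by rewrite coefXM; case: k => [|k]; rewrite ?mulr0n// coef_deriv. Qed.

(** The equation X C' = H C determines each coefficient of C from the previous
    ones. *)
Lemma log_derivative_unique (H C E : {poly R}) N : H`_0 = 0 -> C`_0 = E`_0 ->
  eq_below N ('X * C^`()) (H * C) -> eq_below N ('X * E^`()) (H * E) ->
  eq_below N C E.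
Proof.
move=> H0 CE0 eC eE; elim/ltn_ind => -[//|k] IH kN.
have := eC _ kN; have := eE _ kN; rewrite !coefX_deriv !coefM => Ek Ck.
apply/eqP; rewrite -(@eqr_pMn2r _ k.+1)// Ek Ck; apply/eqP.
apply: eq_bigr => -[[|i] ik] _ /=; first by rewrite H0 !mul0r.
by rewrite IH//; lia.
Qed.

(** From e (1 - b) = e_0 one gets X e' = h e with h = X b' e / e_0, which has
    nonnegative coefficients.  The solution r of X r' = (h / n) r with
    r_0 = e_0^(1/n) is then nonnegative, and r^n satisfies the same equation as
    e with the same constant term.  The computation takes place modulo X^N with
    truncated series. *)
Lemma renewal_root e b n : (0 < n)%N -> (forall j, 0 <= b j) -> 0 < e 0%N ->
  renewal e b ->
  exists2 r, (forall k, 0 <= r k) &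
    iter n.-1 (fun f => cauchy_product f r) r = e.
Proof.
move=> n0 b0 e0 re.
have ege := renewal_ge0 b0 (ltW e0) re.
pose b' := zero_head b.
pose h i := (e 0%N)^-1 * cauchy_product (fun j => b' j *+ j) e i.
have h0 i : 0 <= h i.
  rewrite mulr_ge0 ?invr_ge0 ?ege//; apply: sumr_ge0 => j _.
  by rewrite mulr_ge0// mulrn_wge0//; exact: zero_head_ge0.
have [|r rE] := @strong_recursion R (fun r k => if k is k'.+1 then
    (n%:R^-1 * \sum_(i < k) h i.+1 * r (k' - i)%N) / k%:R else e 0%N `^ n%:R^-1) 0.
  move=> f g [//|k] fg; congr (_ * _ / _); apply: eq_bigr => i _.
  by rewrite fg// ltnS leq_subr.
have r0 : forall k, 0 <= r k.
  elim/ltn_ind => -[|k] IH; rewrite rE; first exact: powR_ge0.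
  rewrite divr_ge0// mulr_ge0 ?invr_ge0//; apply: sumr_ge0 => i _.
  by rewrite mulr_ge0// IH// ltnS leq_subr.
exists r => //; apply/funext => k; set N := k.+1.
rewrite -(@coef_truncationX N)// -(@coef_truncation N e)// prednK//.
pose A := truncation N r; pose E := truncation N e; pose H := truncation N h.
pose B := truncation N b'.
have hz : h 0%N = 0.
  by rewrite /h /cauchy_product big_ord1 mulr0n mul0r mulr0.
apply: (@log_derivative_unique H (A ^+ n) E N) => //.
- by rewrite coef_truncation.
- rewrite -horner_coef0 horner_exp horner_coef0 !coef_truncation// rE.
  by rewrite -powR_mulrn ?powR_ge0// -powRrM mulVf ?pnatr_eq0 -?lt0n// powRr1// ltW.
- have dA : eq_below N ('X * A^`()) (n%:R^-1 *: (H * A)).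
    move=> [|l] lN; rewrite coefX_deriv coefZ.
      by rewrite mulr0n coefM big_ord1 coef_truncation// hz mul0r mulr0.
    rewrite coef_truncationM// /cauchy_product big_ord_recl hz mul0r add0r.
    rewrite coef_truncation// rE /= -[LHS]mulr_natr divfK ?pnatr_eq0//.
  rewrite deriv_exp mulrnAr mulrA.
  have -> : H * A ^+ n = (n%:R^-1 *: (H * A)) * A ^+ n.-1 *+ n.
    rewrite -scalerAl -mulrA -exprS prednK// -scaler_nat scalerA.
    by rewrite mulfV ?scale1r// pnatr_eq0 -lt0n.
  move=> l lN; rewrite !coefMn; congr (_ *+ _).
  exact: (eq_belowM dA (fun _ _ => erefl)).
- have eB : eq_below N (E * (1 - B)) (e 0%N)%:P.
    move=> l lN; rewrite mulrBr mulr1 coefB mulrC coef_truncationM// coef_truncation//.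
    rewrite coefC; case: l => [|l] in lN *.
      by rewrite /cauchy_product big_ord1 mul0r subr0.
    rewrite {1}re// /cauchy_product big_ord_recl mul0r add0r.
    rewrite big_add1/= big_mkord.
    by apply/eqP; rewrite subr_eq0; apply/eqP/eq_bigr.
  have eH : eq_below N ((e 0%N)%:P * H) (('X * B^`()) * E).
    move=> l lN; rewrite coefCM coef_truncation// mulrA mulfV ?gt_eqF// mul1r.
    rewrite coefM; apply: eq_bigr => i _.
    have il : (i <= l)%N by rewrite -ltnS.
    rewrite coefX_deriv !coef_truncation// ?(leq_ltn_trans _ lN)// leq_subr//.
  have dE : eq_below N (('X * E^`()) * (1 - B)) (('X * B^`()) * E).
    move=> l lN; apply/eqP; rewrite -subr_eq0 -coefB; apply/eqP.
    have -> : 'X * E^`() * (1 - B) - 'X * B^`() * E = 'X * (E * (1 - B))^`().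
      by rewrite derivM derivB derivC; ring.
    rewrite coefX_deriv eB// coefC; case: l {lN} => [|l]; rewrite ?mulr0n//=.
    by rewrite mul0rn.
  move=> l lN; apply: (mulIf (x := e 0%N)); first by rewrite gt_eqF.
  rewrite -!coefMC -(eq_belowM (fun _ _ => erefl) eB lN).
  have -> : 'X * E^`() * (E * (1 - B)) = 'X * E^`() * (1 - B) * E by ring.
  rewrite (eq_belowM dE (fun _ _ => erefl) lN).
  rewrite -(eq_belowM eH (fun _ _ => erefl) lN).
  by have -> : H * E * (e 0%N)%:P = (e 0%N)%:P * H * E by ring.
Qed.

End Renewal.

(** * The part not swept is log-convex *)

Section Overshoot.
Context {R : realType}.
Implicit Types (q : int -> R) (a b u : nat -> R).

Lemma logconvex_sum (I : Type) (s : seq I) (P : pred I) (F : I -> nat -> R) :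
  (forall i k, P i -> 0 <= F i k) -> (forall i, P i -> logconvex (F i)) ->
  logconvex (fun k => \sum_(i <- s | P i) F i k).
Proof.
move=> F0 lF; elim: s => [|i s IH] k; first by rewrite !big_nil expr0n mulr0.
rewrite !big_cons; case: ifPn => // Pi.
apply: (logconvexD (u := F i) (v := fun k => \sum_(j <- s | P j) F j k)) => //.
- by move=> j; exact: F0.
- by move=> j; apply: sumr_ge0 => l; exact: F0.
- exact: lF.
Qed.

Lemma logconvex_shift a n : logconvex a -> logconvex (fun k => a (k + n)%N).
Proof. by move=> la k; have := la (k + n)%N; rewrite !addSn. Qed.

Lemma logconvex_limit (f : nat -> nat -> R) u :
  (forall M, logconvex (f M)) -> (forall k, f M k @[M --> \oo] --> u k) -> logconvex u.
Proof.
move=> lf fu k.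
have sq : f M k.+1 ^+ 2 @[M --> \oo] --> u k.+1 ^+ 2.
  by rewrite expr2; under eq_fun do rewrite expr2; exact: cvgM.
by apply: (ler_cvg_to sq (cvgM (fu k) (fu k.+2))); apply: nearW => M; exact: lf.
Qed.

Lemma profile_shift_le a k j : profile a -> a (k + j)%N <= a k.
Proof.
move=> ma; rewrite -subr_ge0 -sum_drop ?leq_addr//.
by apply: sumr_ge0 => i _; exact: profile_drop_ge0.
Qed.

(** Rewriting a_k - a_{k+j} as a sum of j drops exhibits the expression as a
    combination of log-convex sequences with nonnegative coefficients. *)
Lemma logconvex_overshoot a b M : profile a -> (forall j, 0 <= b j) ->
  \sum_(1 <= j < M.+1) b j <= 1 ->
  logconvex (fun k => a k - \sum_(1 <= j < M.+1) b j * a (k + j)%N).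
Proof.
move=> ma b0 b1.
have -> : (fun k => a k - \sum_(1 <= j < M.+1) b j * a (k + j)%N) =
    (fun k => (1 - \sum_(1 <= j < M.+1) b j) * a k +
      \sum_(1 <= j < M.+1) b j * \sum_(0 <= i < j) drop_of a (k + i)%N).
  apply/funext => k; rewrite mulrBl mul1r mulr_suml -addrA; congr (_ + _).
  rewrite -!sumrN -big_split/=; apply: eq_bigr => j _.
  have -> : \sum_(0 <= i < j) drop_of a (k + i)%N = a k - a (k + j)%N.
    elim: j => [|j IH]; first by rewrite big_geq// addn0 subrr.
    by rewrite big_nat_recr//= IH /drop_of addnS; ring.
  ring.
have d0 := profile_drop_ge0 ma.
apply: logconvexD.
- by move=> k; rewrite mulr_ge0 ?subr_ge0// profile_ge0.
- by move=> k; apply: sumr_ge0 => j _; rewrite mulr_ge0// sumr_ge0.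
- by apply: logconvexZ; exact: profile_logconvex.
- apply: logconvex_sum => [j k _|j _]; first by rewrite mulr_ge0// sumr_ge0.
  apply: logconvexZ; apply: logconvex_sum => // i _.
  exact: (logconvex_shift i (profile_drop_logconvex ma)).
Qed.

(** Let A be the sum of q over k >= 0.  Summing the sweeping inequality over
    x >= 1 gives A - q 0 on the right, and on the left at least b_j A for each j,
    because x - j runs through all nonnegative integers. *)
Lemma sweep_mass_lt1 q b : profile (right_part q) -> (forall x, 0 <= q x) -> 0 < q 0 ->
  (forall j, 0 <= b j) ->
  (forall M x, (0 < x)%N -> \sum_(1 <= j < M.+1) b j * q (x%:Z - j%:Z) <= q x%:Z) ->
  exists2 rho, rho < 1 & forall M, \sum_(1 <= j < M.+1) b j <= rho.
Proof.
move=> mr q0 q00 b0 bq; pose r := right_part q.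
have r0 : forall k, 0 <= r k by exact: profile_ge0.
have cr := profile_summable mr; pose A := limn (series r).
have serA n : series r n <= A.
  have := @sum_tail_le _ r n n r0 cr; rewrite big_geq//; rewrite subr_ge0; exact.
have A0 : 0 < A.
  by apply: lt_le_trans (serA 1%N); rewrite /series/= big_nat1.
exists (1 - q 0 / A); first by rewrite gtrBl divr_gt0.
move=> M; rewrite -(ler_pM2r A0) mulrBl mul1r divfK ?gt_eqF//.
have cvgA : (\sum_(1 <= j < M.+1) b j) * series r n @[n --> \oo] -->
    (\sum_(1 <= j < M.+1) b j) * A by apply: cvgM; [exact: cvg_cst|exact: cr].
apply: (cvgr_to_le cvgA); apply: nearW => n.
apply: (@le_trans _ _ (\sum_(1 <= x < (n + M).+1) q x%:Z)); last first.
  rewrite lerBrDr; apply: le_trans (serA (n + M).+1).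
  by rewrite /series/= [leRHS]big_nat_recl//= addrC lerD2l big_add1.
apply: (@le_trans _ _ (\sum_(1 <= x < (n + M).+1)
    \sum_(1 <= j < M.+1) b j * q (x%:Z - j%:Z))); last first.
  by apply: ler_sum_nat => x /andP[x0 _]; exact: bq.
rewrite exchange_big/= mulr_suml; apply: ler_sum_nat => j /andP[j0 jM].
rewrite -mulr_sumr ler_wpM2l// /series/=.
have jnM : (j <= (n + M).+1)%N by lia.
rewrite [leRHS](big_cat_nat (n := j))//= ler_wpDl ?sumr_ge0//.
rewrite -{1}(add0n j) big_addn [leRHS](big_cat_nat (n := n)) ?leq0n//=; last by lia.
rewrite ler_wpDr ?sumr_ge0//; apply: ler_sum => i _.
by rewrite /r /right_part; have -> : (i + j)%N%:Z - j%:Z = i%:Z by lia.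
Qed.

(** The decomposition q = b * q + u, with u carried by the nonpositive integers
    and indexed by the distance to 0. *)
Lemma sweep_decomposition q : profile (right_part q) -> profile (right_part (reflect_int q)) ->
  0 < q 0 ->
  exists b u rho, [/\ (forall j, 0 <= b j),
    (rho < 1 /\ forall M, \sum_(1 <= j < M.+1) b j <= rho),
    (forall k, 0 <= u k <= q (- k%:Z)), (0 < u 0%N /\ logconvex u) &
    forall x, \sum_(1 <= j < M.+1) b j * q (x - j%:Z) @[M --> \oo] -->
      q x - (if x <= 0 then u `|x|%N else 0)].
Proof.
move=> mr ml q00.
have [b b0 bq] := sweep_limit mr ml.
have q0 y : 0 <= q y.
  by apply: (int_right_or_left (P := fun y => 0 <= y)); exact: profile_ge0.
have [|rho rho1 brho] := sweep_mass_lt1 mr q0 q00 b0.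
  move=> M x x0; apply: (cvgr_to_ge (bq x x0)).
  exists M => // n /= Mn; rewrite [leRHS](big_cat_nat (n := M.+1))//=.
  by rewrite ler_wpDr// sumr_ge0// => j _; rewrite mulr_ge0.
have b1 M : \sum_(1 <= j < M.+1) b j <= 1 by rewrite (le_trans (brho M))// ltW.
pose l := right_part (reflect_int q).
have l0 : forall k, 0 <= l k by exact: profile_ge0.
pose S k M := \sum_(1 <= j < M.+1) b j * l (k + j)%N.
have Sle k M : S k M <= rho * l k.
  apply: le_trans (ler_wpM2r (l0 k) (brho M)).
  rewrite mulr_suml; apply: ler_sum => j _.
  by rewrite ler_wpM2l// profile_shift_le.
have cS k : cvgn (S k).
  apply: nondecreasing_is_cvgn.
    apply/nondecreasing_seqP => M; rewrite /S [leRHS]big_nat_recr//= lerDl.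
    by rewrite mulr_ge0.
  by exists (rho * l k) => _ [M _ <-].
pose u k := l k - limn (S k).
have ucvg k : l k - S k M @[M --> \oo] --> u k.
  by apply: cvgB; [exact: cvg_cst|exact: cS].
have ulo k : (1 - rho) * l k <= u k.
  by rewrite mulrBl mul1r lerD2l lerN2; apply: limr_le => //; exact: nearW.
exists b, u, rho; split => //.
- move=> k; rewrite (le_trans _ (ulo k)) ?mulr_ge0 ?subr_ge0 ?(ltW rho1)//=.
  rewrite gerBl; apply: limr_ge => //; apply: nearW => M.
  by apply: sumr_ge0 => j _; rewrite mulr_ge0.
- split; first by apply: lt_le_trans (ulo 0%N); rewrite mulr_gt0 ?subr_gt0.
  by apply: logconvex_limit ucvg => M; exact: logconvex_overshoot.
move=> x; case: ifPn => x0; last first.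
  rewrite subr0; case: x x0 => [[//|x]|//] _; exact: bq.
have -> : x = - `|x|%N%:Z by lia.
rewrite abszN absz_nat.
have -> : q (- `|x|%N%:Z) - u `|x|%N = limn (S `|x|%N).
  by rewrite -[q _]/(l `|x|%N) /u; ring.
rewrite (_ : (fun M => _) = S `|x|%N); first exact: cS.
apply/funext => M; apply: eq_bigr => j _; congr (_ * _).
by rewrite /l /right_part /reflect_int; congr q; lia.
Qed.

End Overshoot.

(** * Convolution on the integers *)

Section Esum.
Context {R : realType}.
Local Open Scope ereal_scope.

Lemma esumZl (T : choiceType) (c : \bar R) (f : T -> \bar R) :
  0 <= c -> (forall i, 0 <= f i) ->
  \esum_(i in [set: T]) (c * f i) = c * \esum_(i in [set: T]) f i.
Proof.
move=> c0 f0; case: c c0 => [r| |//] c0.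
- move: c0; rewrite lee_fin le_eqVlt => /orP[/eqP <-|r0].
    by rewrite mul0e esum1// => i _; rewrite mul0e.
  rewrite /esum -ereal_sup_pZl//; congr ereal_sup; apply/seteqP; split => x /=.
    move=> [A fA <-]; exists (\sum_(i \in A) f i); first by exists A.
    by rewrite ge0_mule_fsumr.
  move=> [_ [A fA <-] <-]; exists A => //.
  by rewrite ge0_mule_fsumr.
- have [f00|] := pselect (forall i, f i = 0).
    by rewrite !esum1 ?mule0// => i _; rewrite f00 mule0.
  move=> /existsNP[i fi].
  have fip : 0 < f i by rewrite lt_neqAle f0 eq_sym andbT; exact/eqP.
  have le1 (g : T -> \bar R) : (forall j, 0 <= g j) ->
      g i <= \esum_(j in [set: T]) g j.
    move=> g0; apply: esum_ge; exists [set i]; last by rewrite fsbig_set1.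
    by split.
  rewrite gt0_mulye; last exact: lt_le_trans fip (le1 _ f0).
  apply/eqP; rewrite -leye_eq.
  have := le1 (fun j => +oo * f j) (fun j => mule_ge0 (leey _) (f0 j)).
  by rewrite gt0_mulye.
Qed.

Lemma exchange_esum (T T' : choiceType) (a : T -> T' -> \bar R) :
  (forall i j, 0 <= a i j) ->
  \esum_(i in [set: T]) \esum_(j in [set: T']) a i j =
  \esum_(j in [set: T']) \esum_(i in [set: T]) a i j.
Proof.
move=> a0; rewrite !esum_esum//.
rewrite (reindex_esum ([set: T'] `*`` (fun=> [set: T])) _ (fun x => (x.2, x.1)))//.
split => //= [[i j] [i' j'] _ _ /= [-> ->]//|[i j] _ /=].
by exists (j, i).
Qed.

Lemma esum_bij (T : choiceType) (e e' : T -> T) (a : T -> \bar R) :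
  cancel e e' -> cancel e' e ->
  \esum_(i in [set: T]) a i = \esum_(i in [set: T]) a (e i).
Proof.
move=> ee' e'e; apply: reindex_esum; split => //= [x y _ _|x _].
  exact: (can_inj ee').
by exists (e' x).
Qed.

(** Values in the extended reals make every convolution of nonnegative functions
    meaningful, so that summability of the roots need not be known in
    advance. *)
Definition iconv (f g : int -> \bar R) (x : int) : \bar R :=
  \esum_(j in [set: int]) (f j * g (x - j)%R).

Implicit Types f g h : int -> \bar R.

Lemma iconv_ge0 f g : (forall i, 0 <= f i) -> (forall i, 0 <= g i) ->
  forall x, 0 <= iconv f g x.
Proof. by move=> f0 g0 x; apply: esum_ge0 => j _; rewrite mule_ge0. Qed.

Lemma iconvC f g : iconv f g = iconv g f.
Proof.
apply/funext => x; rewrite /iconv (@esum_bij _ (fun j => x - j)%R (fun j => x - j)%R).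
- by apply: eq_esum => j _; rewrite muleC subKr.
- by move=> j; rewrite subKr.
- by move=> j; rewrite subKr.
Qed.

Lemma esum_shift (a : int -> \bar R) (k : int) :
  \esum_(i in [set: int]) a i = \esum_(i in [set: int]) a (i - k)%R.
Proof.
by apply: (@esum_bij _ _ (fun j => j + k)%R) => j; [exact: subrK|exact: addrK].
Qed.

Lemma iconvA f g h : (forall i, 0 <= f i) -> (forall i, 0 <= g i) ->
  (forall i, 0 <= h i) -> iconv (iconv f g) h = iconv f (iconv g h).
Proof.
move=> f0 g0 h0; apply/funext => x; rewrite /iconv.
under eq_esum => j _.
  rewrite muleC -esumZl//; last by move=> i; rewrite mule_ge0.
  over.
rewrite exchange_esum; last by move=> i j; rewrite !mule_ge0.
apply: eq_esum => i _; rewrite -esumZl//; last by move=> j; rewrite mule_ge0.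
rewrite [RHS](esum_shift _ i); apply: eq_esum => j _.
by rewrite muleC -muleA; congr (_ * (_ * h _)); ring.
Qed.

Lemma esum_iconv f g : (forall i, 0 <= f i) -> (forall i, 0 <= g i) ->
  \esum_(x in [set: int]) iconv f g x =
  (\esum_(x in [set: int]) f x) * (\esum_(x in [set: int]) g x).
Proof.
move=> f0 g0; rewrite /iconv exchange_esum; last by move=> i j; rewrite mule_ge0.
rewrite muleC -esumZl ?esum_ge0//; apply: eq_esum => j _.
by rewrite esumZl// -(esum_shift g j) muleC.
Qed.

(** The (n + 1)-fold convolution power. *)
Definition iconv_pow f (n : nat) : int -> \bar R := iter n (iconv^~ f) f.

Lemma iconv_pow_ge0 f n : (forall i, 0 <= f i) -> forall x, 0 <= iconv_pow f n x.
Proof. by move=> f0; elim: n => // n IH x; exact: iconv_ge0. Qed.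

Lemma iconv_powM f g n : (forall i, 0 <= f i) -> (forall i, 0 <= g i) ->
  iconv_pow (iconv f g) n = iconv (iconv_pow f n) (iconv_pow g n).
Proof.
move=> f0 g0; elim: n => // n IH.
rewrite /iconv_pow !iterS -!/(iconv_pow _ _) IH.
have F0 := iconv_pow_ge0 n f0; have G0 := iconv_pow_ge0 n g0.
rewrite !iconvA//; [|exact: iconv_ge0..].
by rewrite -(iconvA G0 f0 g0) (iconvC _ f) (iconvA f0 G0 g0).
Qed.

Lemma esum_iconv_pow f n : (forall i, 0 <= f i) ->
  \esum_(x in [set: int]) iconv_pow f n x = (\esum_(x in [set: int]) f x) ^+ n.+1.
Proof.
move=> f0; elim: n => [|n IH]; first by [].
rewrite /iconv_pow iterS -/(iconv_pow _ _) esum_iconv ?IH//; last first.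
  exact: iconv_pow_ge0.
by rewrite [RHS]expeS muleC.
Qed.

(** A convolution root of a probability distribution has total mass 1, since
    masses multiply. *)
Lemma esum_iconv_pow_eq1 f n : (forall i, 0 <= f i) ->
  \esum_(x in [set: int]) iconv_pow f n x = 1 -> \esum_(x in [set: int]) f x = 1.
Proof.
move=> f0; rewrite esum_iconv_pow//.
have : 0 <= \esum_(x in [set: int]) f x by exact: esum_ge0.
move: (\esum_(x in _) f x) => [r| |]//.
  rewrite lee_fin => r0; rewrite -EFin_expe => -[/eqP].
  by rewrite pexpr_eq1// => /eqP ->.
move=> _; suff -> : (+oo : \bar R) ^+ n.+1 = +oo by [].
by elim: n => // n IH; rewrite expeS IH gt0_mulye.
Qed.

Definition right_embed (a : nat -> R) (x : int) : \bar R :=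
  if x is Posz k then (a k)%:E else 0.

Lemma right_embed_ge0 a : (forall k, (0 <= a k)%R) -> forall x, 0 <= right_embed a x.
Proof. by move=> a0 [k|k]//=; rewrite lee_fin. Qed.

Lemma esum_right_embed (a : nat -> R) (F : int -> \bar R) :
  (forall k, (0 <= a k)%R) -> (forall x, 0 <= F x) ->
  \esum_(x in [set: int]) (right_embed a x * F x) =
  \sum_(0 <= k <oo) ((a k)%:E * F k%:Z).
Proof.
move=> a0 F0.
rewrite nneseries_esumT; last by move=> k; rewrite mule_ge0 ?lee_fin.
have -> : \esum_(k in [set: nat]) ((a k)%:E * F k%:Z) =
    \esum_(x in range Posz) (right_embed a x * F x).
  by rewrite esum_image// => i j _ _ [].
rewrite [RHS]esum_mkcond; apply: eq_esum => -[k|k] _.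
  by rewrite mem_set//; exists k.
by rewrite memNset ?mul0e// => -[].
Qed.

Lemma iconv_right_embed (a b : nat -> R) : (forall k, (0 <= a k)%R) ->
  (forall k, (0 <= b k)%R) ->
  iconv (right_embed a) (right_embed b) = right_embed (cauchy_product a b).
Proof.
move=> a0 b0; apply/funext => x; rewrite /iconv esum_right_embed//; last first.
  by move=> y; exact: right_embed_ge0.
have zero (k : nat) : ~~ (k%:Z <= x)%R -> right_embed b (x - k%:Z)%R = 0.
  by rewrite -ltNge -subr_lt0; case: (_ - _)%R => // l; rewrite ltNge lez_nat.
case: x zero => [n|n] zero; last first.
  rewrite eseries0// => k _ _; rewrite zero ?mule0//; lia.
rewrite (nneseries_split 0 n.+1); last first.
  by move=> k _; rewrite mule_ge0 ?lee_fin// right_embed_ge0.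
rewrite [X in _ + X]eseries0 ?adde0; last first.
  by move=> k nk _; rewrite zero ?mule0// -ltNge; lia.
rewrite add0n big_mkord /= /cauchy_product -sumEFin; apply: eq_bigr => i _.
have -> : (n%:Z - i%:Z)%R = (n - i)%N%:Z by have := ltn_ord i; lia.
by rewrite EFinM.
Qed.

Lemma right_embed_pow a n : (forall k, (0 <= a k)%R) ->
  iconv_pow (right_embed a) n =
  right_embed (iter n (fun c => cauchy_product c a) a).
Proof.
move=> a0; elim: n => // n IH; rewrite /iconv_pow !iterS -/(iconv_pow _ _) IH.
rewrite iconv_right_embed//; elim: n {IH} => // n IH k.
by apply: sumr_ge0 => i _; rewrite mulr_ge0//; exact: IH.
Qed.

Definition left_embed (a : nat -> R) (x : int) : \bar R := right_embed a (- x)%R.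

Lemma iconv_reflect f g x :
  iconv (fun y => f (- y)%R) (fun y => g (- y)%R) x = iconv f g (- x)%R.
Proof.
rewrite /iconv [RHS](@esum_bij _ -%R -%R); [|exact: opprK..].
by apply: eq_esum => j _; rewrite opprB opprK addrC.
Qed.

Lemma left_embed_pow a n : (forall k, (0 <= a k)%R) ->
  iconv_pow (left_embed a) n =
  left_embed (iter n (fun c => cauchy_product c a) a).
Proof.
move=> a0; apply/funext => x; rewrite /left_embed -right_embed_pow//.
elim: n x => // n IH x; rewrite /iconv_pow !iterS -!/(iconv_pow _ _).
by rewrite -iconv_reflect; congr (iconv _ _ x); apply/funext.
Qed.

End Esum.

(** * Wiener-Hopf factorization *)

Section Factor.
Context {R : realType}.
Local Open Scope ereal_scope.
Implicit Types f g h B U : int -> \bar R.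

Lemma iconvDl f g h : (forall i, 0 <= f i) -> (forall i, 0 <= g i) ->
  (forall i, 0 <= h i) ->
  iconv (f \+ g) h = iconv f h \+ iconv g h.
Proof.
move=> f0 g0 h0; apply/funext => x; rewrite /iconv /= -esumD.
- by apply: eq_esum => j _; rewrite ge0_muleDl.
- by move=> j _; rewrite mule_ge0.
- by move=> j _; rewrite mule_ge0.
Qed.

(** Uniqueness of bounded solutions of f = U + B * f when B has mass rho < 1:
    a bound f <= g + c improves to f <= g + rho c. *)
Lemma renewal_equation_le B U f g (rho : R) : (rho < 1)%R ->
  (forall i, 0 <= B i) -> \esum_(i in [set: int]) B i <= rho%:E ->
  (forall i, 0 <= f i <= 1) -> (forall i, 0 <= g i) ->
  f = U \+ iconv B f -> g = U \+ iconv B g -> forall x, f x <= g x.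
Proof.
move=> rho1 B0 Brho f01 g0 fE gE.
have rho0 : (0 <= rho)%R by rewrite -lee_fin (le_trans _ Brho)// esum_ge0.
have bound n : forall x, f x <= g x + (rho ^+ n)%:E.
  elim: n => [|n IH] x.
    by rewrite expr0 (le_trans (andP (f01 x)).2)// leeDr.
  rewrite {1}fE [in leRHS]gE /= -addeA leeD2l//.
  apply: (@le_trans _ _ (\esum_(j in [set: int])
      (B j * g (x - j)%R + (rho ^+ n)%:E * B j))).
    apply: le_esum => j _; apply: (le_trans (lee_wpmul2l (B0 j) (IH _))).
    by rewrite ge0_muleDr ?lee_fin ?exprn_ge0// [X in _ + X]muleC.
  have rn0 : 0 <= (rho ^+ n)%:E by rewrite lee_fin exprn_ge0.
  rewrite esumD; [|by move=> j _; rewrite mule_ge0..].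
  rewrite leeD2l// esumZl// exprSr EFinM.
  exact: lee_wpmul2l.
move=> x; have cvgr : g x + (rho ^+ n)%:E @[n --> \oo] --> g x.
  rewrite -[X in _ --> X]adde0; apply: cvgeD.
  - exact: fin_num_adde_defl.
  - exact: cvg_cst.
  - apply: cvg_EFin; first exact: nearW.
    by apply: cvg_expr; rewrite ger0_norm.
apply: (cvge_ge _ cvgr); exact: nearW.
Qed.

Lemma renewal_embed (e b : nat -> R) : (forall k, 0 <= e k)%R -> (forall k, 0 <= b k)%R ->
  e 0%N = 1%R -> renewal e b ->
  right_embed e = right_embed (fun k => (k == 0%N)%:R) \+
    iconv (right_embed (zero_head b)) (right_embed e).
Proof.
move=> e_ge0 b0 e0 re; rewrite iconv_right_embed//; last exact: zero_head_ge0.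
apply/funext => -[[|k]|k] /=; rewrite ?adde0//.
  by rewrite /cauchy_product big_ord1 /= mul0r adde0 e0.
rewrite add0e /cauchy_product re// big_add1/= big_mkord; congr EFin.
by rewrite [RHS]big_ord_recl mul0r add0r; apply: eq_bigr.
Qed.

Lemma iconv_delta U : (forall x, 0 <= U x) ->
  iconv (right_embed (fun k => (k == 0%N)%:R)) U = U.
Proof.
move=> U0; apply/funext => x; rewrite /iconv esum_right_embed//.
rewrite (nneseries_split 0 1); last by move=> k _; rewrite mule_ge0.
rewrite [X in _ + X]eseries0 ?adde0; last by move=> [//|k] _ _; rewrite mul0e.
by rewrite big_nat1 mul1e subr0.
Qed.

Lemma iconv_right_lim (b : nat -> R) (q : int -> R) (s : R) (x : int) :
  (forall k, 0 <= b k)%R -> (forall k, 0 <= q k)%R ->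
  (\sum_(1 <= j < M.+1) b j * q (x - j%:Z))%R @[M --> \oo] --> s ->
  iconv (right_embed (zero_head b)) (EFin \o q) x = s%:E.
Proof.
move=> b0 q0 cs; rewrite /iconv esum_right_embed; last 2 first.
- exact: zero_head_ge0.
- by move=> y; rewrite lee_fin.
apply/cvg_lim => //; rewrite -cvg_shiftS.
have -> : (fun n => \sum_(0 <= k < n.+1) ((zero_head b k)%:E * (EFin \o q) (x - k%:Z)%R)) =
    EFin \o (fun M => \sum_(1 <= j < M.+1) b j * q (x - j%:Z))%R.
  apply/funext => M /=; rewrite big_nat_recl//= mul0e add0e -sumEFin.
  by rewrite big_add1/=; apply: eq_bigr.
by apply: cvg_EFin; [exact: nearW|].
Qed.

(** Both q and e * u are solutions, with values in [0, 1], of the equation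
    f = u + b * f. *)
Lemma wiener_hopf (q : int -> R) : profile (right_part q) ->
  profile (right_part (reflect_int q)) ->
  \esum_(k in [set: int]) (q k)%:E = 1 ->
  exists e b u c, [/\ (forall k, 0 <= b k)%R /\ (0 < e 0%N)%R, renewal e b,
    (forall k, 0 <= c k)%R /\ (0 < u 0%N)%R, renewal u c &
    EFin \o q = iconv (right_embed e) (left_embed u)].
Proof.
move=> mr ml q1.
have q0 y : (0 <= q y)%R.
  by apply: (int_right_or_left (P := fun y => (0 <= y)%R)); exact: profile_ge0.
have q00 : (0 < q 0)%R.
  rewrite lt_neqAle q0 andbT eq_sym; apply/eqP => q00.
  have qz y : (q y <= 0)%R.
    apply: (int_right_or_left (P := fun y => (y <= 0)%R)) => k.
      by rewrite -q00; exact/(drop_ge0_le0 (a := right_part q))/profile_drop_ge0.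
    rewrite -q00 -[q 0%R]/(right_part (reflect_int q) 0).
    exact/drop_ge0_le0/profile_drop_ge0.
  move: q1; rewrite esum1 => [/eqP|k _]; first by rewrite eq_sym onee_eq0.
  by congr EFin; apply/eqP; rewrite eq_le q0 qz.
have [b [u [rho [b0 [rho1 brho] ule [u0 ulc] qdec]]]] := sweep_decomposition mr ml q00.
have uge k : (0 <= u k)%R by case/andP: (ule k).
have [c c0 uc] := logconvex_renewal uge u0 ulc.
have [e e0 eb] := renewal_exists b.
have e_ge0 := renewal_ge0 b0 _ eb; rewrite e0 ler01 in e_ge0.
have {}e_ge0 := e_ge0 isT.
exists e, b, u, c; split; rewrite ?e0//.
set B := right_embed (zero_head b); pose U := left_embed u.
have B0 : forall i, 0 <= B i by exact/right_embed_ge0/zero_head_ge0.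
have U0 i : 0 <= U i by exact: right_embed_ge0.
have E0 : forall i, 0 <= right_embed e i by exact: right_embed_ge0.
have Brho : \esum_(i in [set: int]) B i <= rho%:E.
  have -> : \esum_(i in [set: int]) B i = \esum_(i in [set: int]) (B i * 1).
    by apply: eq_esum => i _; rewrite mule1.
  rewrite esum_right_embed//; last exact: zero_head_ge0.
  apply: lime_le; first by apply: is_cvg_nneseries => k _ _; rewrite mule1 lee_fin zero_head_ge0.
  apply: nearW => -[|n]; first by rewrite big_geq// lee_fin (le_trans _ (brho 0%N))// big_geq.
  rewrite big_nat_recl//= mul0e add0e; under eq_bigr do rewrite mule1.
  by rewrite sumEFin lee_fin (le_trans _ (brho n))// [leRHS]big_add1.
have QE : EFin \o q = U \+ iconv B (EFin \o q).
  apply/funext => x /=; rewrite (iconv_right_lim b0 q0 (qdec x)).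
  suff -> : U x = (if (x <= 0)%R then u `|x|%N else 0%R)%:E by rewrite -EFinD addrC subrK.
  by case: x => [[|n]|n].
have hE : iconv (right_embed e) U = U \+ iconv B (iconv (right_embed e) U).
  rewrite {1}(renewal_embed e_ge0 b0 e0 eb) iconvDl//.
  - by rewrite iconv_delta// iconvA.
  - by apply: right_embed_ge0 => k; case: eqP.
  - exact: iconv_ge0.
have e1 i : right_embed e i <= 1.
  case: i => [k|k] //=; rewrite lee_fin; apply: renewal_le1 e0 eb _ => // M.
  by rewrite (le_trans (brho M))// ltW.
have UQ i : U i <= (q i)%:E.
  rewrite -[in leRHS](opprK i) /U /left_embed; case: (- i)%R => [k|k] /=.
    by rewrite lee_fin; case/andP: (ule k).
  by rewrite lee_fin.
have h1 x : iconv (right_embed e) U x <= 1.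
  rewrite -q1 (@esum_bij _ _ (fun j => x - j)%R (fun j => x - j)%R); [|exact: subKr..].
  apply: le_esum => j _; rewrite -[leRHS]mul1e.
  by apply: lee_pmul.
have Q1 x : 0 <= (EFin \o q) x <= 1.
  rewrite lee_fin q0/= -q1; apply: esum_ge; exists [set x]; first by split.
  by rewrite fsbig_set1.
have h0 : forall x, 0 <= iconv (right_embed e) U x by exact: iconv_ge0.
apply/funext => x; apply/eqP; rewrite eq_le; apply/andP; split.
  exact: (renewal_equation_le rho1 B0 Brho Q1 h0 QE hE).
apply: (renewal_equation_le rho1 B0 Brho _ _ hE QE) => [y|y].
  by rewrite h0 h1.
by rewrite lee_fin.
Qed.

Lemma root_decomposition (q : int -> R) n : (0 < n)%N -> profile (right_part q) ->
  profile (right_part (reflect_int q)) ->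
  \esum_(k in [set: int]) (q k)%:E = 1 ->
  exists g : int -> \bar R, [/\ forall x, 0 <= g x,
    \esum_(k in [set: int]) g k = 1 & iconv_pow g n.-1 = EFin \o q].
Proof.
move=> n0 mr ml q1; have [e [b [u [c [[b0 e0] eb [c0 u0] uc qE]]]]] := wiener_hopf mr ml q1.
have [r r0 re] := renewal_root n0 b0 e0 eb.
have [s s0 su] := renewal_root n0 c0 u0 uc.
have R0 := right_embed_ge0 r0.
have S0 x : 0 <= left_embed s x by exact: right_embed_ge0.
have gn : iconv_pow (iconv (right_embed r) (left_embed s)) n.-1 = EFin \o q.
  by rewrite iconv_powM// right_embed_pow// left_embed_pow// re su qE.
exists (iconv (right_embed r) (left_embed s)); split => //.
  exact: iconv_ge0.
apply: (@esum_iconv_pow_eq1 _ _ n.-1); first exact: iconv_ge0.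
by rewrite gn.
Qed.

End Factor.

(** * Distribution functions on the integer lattice *)

Section DiscreteDf.
Context {R : realType}.
Local Open Scope ereal_scope.

Lemma probability_df (P : probability (measurableTypeR R) R) :
  exists2 G : cumulativeBounded (0 : R) (1 : R),
    forall r, G r = fine (P `]-oo, r]%classic) &
    forall A, measurable A -> lebesgue_stieltjes_measure G A = P A.
Proof.
pose X : {RV P >-> R} := HB.pack (idfun : measurableTypeR R -> R)
  (@isMeasurableFun.Build _ _ _ _ (idfun : measurableTypeR R -> R)
    (@measurable_id _ _ setT)).
pose F r := fine (cdf X r).
have Fnd : nondecreasing F.
  by move=> r s rs; rewrite fine_le ?fin_num_measure// cdf_nondecreasing.
have Frc : right_continuous F.
  move=> r; apply: fine_cvg.
  by rewrite fineK ?fin_num_measure//; exact: cdf_right_continuous.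
have F0 : F @ -oo%R --> (0 : R)%R by exact/fine_cvg/cvg_cdfNy0.
have F1 : F @ +oo%R --> (1 : R)%R by exact/fine_cvg/cvg_cdfy1.
pose G : cumulativeBounded (0 : R) (1 : R) := HB.pack F
  (isCumulative.Build R _ R F Fnd Frc) (isCumulativeBounded.Build R 0%R 1%R F F0 F1).
exists G => // A mA.
exact: lebesgue_stieltjes_cdf_id.
Qed.

Lemma int_enumeration : exists e : nat -> int, set_bij [set: nat] [set: int] e.
Proof.
exists (fun n => if odd n then Negz n./2 else Posz n./2); split => //.
  move=> m n _ _; case: (boolP (odd m)) (odd_double_half m) => om <-;
    case: (boolP (odd n)) (odd_double_half n) => on <- //= [];
    by rewrite ?uphalf_double ?doubleK => ->.
move=> [k|k] _ /=; first by exists k.*2 => //; rewrite odd_double doubleK.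
by exists k.*2.+1 => //=; rewrite odd_double uphalf_double.
Qed.

(** The counterpart of [int_df] for mass functions with extended real values. *)
Definition lattice_df (f : int -> \bar R) (x : R) : R :=
  fine (\esum_(k in [set k : int | (k%:~R <= x)%R]) f k).

(** The measure is a series of weighted Dirac masses along an enumeration of the
    integers. *)
Lemma discrete_probability (g : int -> \bar R) : (forall k, 0 <= g k) ->
  \esum_(k in [set: int]) g k = 1 ->
  exists P : probability (measurableTypeR R) R, forall phi : measurableTypeR R -> \bar R,
    measurable_fun setT phi -> (forall y, 0 <= phi y) ->
    \int[P]_y phi y = \esum_(k in [set: int]) (g k * phi k%:~R%R).
Proof.
move=> g0 g1; have [e be] := int_enumeration.
have gfin k : g k \is a fin_num.
  rewrite ge0_fin_numE//; apply: le_lt_trans (ltry 1); rewrite -g1.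
  by apply: esum_ge; exists [set k]; [split|rewrite fsbig_set1].
pose m n : {measure set measurableTypeR R -> \bar R} :=
  mscale (NngNum (fine_ge0 (g0 (e n)))) \d_((e n)%:~R%R : measurableTypeR R).
pose mu : {measure set measurableTypeR R -> \bar R} := mseries m 0.
have intmu (phi : measurableTypeR R -> \bar R) : measurable_fun setT phi ->
    (forall y, 0 <= phi y) ->
    \int[mu]_y phi y = \esum_(k in [set: int]) (g k * phi k%:~R%R).
  move=> mphi phi0; rewrite ge0_integral_measure_series//.
  rewrite (reindex_esum _ _ e _ be) -nneseries_esumT; last first.
    by move=> n; rewrite mule_ge0.
  apply: eq_eseriesr => n _.
  by rewrite ge0_integral_mscale//= integral_dirac//= diracT mul1e fineK.
have mu1 : mu [set: _] = 1.
  rewrite -g1 -[LHS]mul1e -integral_cst//= intmu//.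
  by apply: eq_esum => k _; rewrite mule1.
pose P : probability (measurableTypeR R) R :=
  HB.pack (mseries m 0) (Measure_isProbability.Build _ _ _ (mseries m 0) mu1).
by exists P.
Qed.

Lemma discrete_df (g : int -> \bar R) : (forall k, 0 <= g k) ->
  \esum_(k in [set: int]) g k = 1 ->
  exists2 G : cumulativeBounded (0 : R) (1 : R), G = lattice_df g :> (R -> R) &
    forall phi : measurableTypeR R -> \bar R,
    measurable_fun setT phi -> (forall y, 0 <= phi y) ->
    \int[lebesgue_stieltjes_measure G]_y phi y =
    \esum_(k in [set: int]) (g k * phi k%:~R%R).
Proof.
move=> g0 g1; have [P intP] := discrete_probability g0 g1.
have [G GE GP] := probability_df P; exists G.
  apply/funext => x; rewrite GE /lattice_df; congr fine.
  rewrite -[in LHS](setIT `]-oo, x]%classic) -integral_indic// intP//; last first.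
    by apply/measurable_EFinP; exact: measurable_indic.
  rewrite [RHS]esum_mkcond; apply: eq_esum => k _.
  rewrite indicE; have [kx|kx] := boolP (k%:~R <= x)%R.
    by rewrite !mem_set ?mule1//= in_itv.
  by rewrite !memNset ?mule0//= ?in_itv; exact/negP.
move=> phi mphi phi0; rewrite -intP//; apply: eq_measure_integral => A mA _.
exact: GP.
Qed.

Lemma lattice_df_fin (f : int -> \bar R) (x : R) : (forall k, 0 <= f k) ->
  \esum_(k in [set: int]) f k = 1 ->
  (lattice_df f x)%:E =
  \esum_(k in [set: int]) (if (k%:~R <= x)%R then f k else 0).
Proof.
move=> f0 f1; rewrite /lattice_df fineK.
  rewrite esum_mkcond; apply: eq_esum => k _.
  have [kx|/negP kx] := boolP (k%:~R <= x)%R; first by rewrite mem_set.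
  by rewrite memNset.
rewrite ge0_fin_numE ?esum_ge0//; apply: le_lt_trans (ltry 1).
by rewrite -f1 esum_mkcond; apply: le_esum => k _; case: ifP.
Qed.

Lemma lattice_df_nondecreasing (f : int -> \bar R) : (forall k, 0 <= f k) ->
  \esum_(k in [set: int]) f k = 1 -> {homo lattice_df f : x y / (x <= y)%R}.
Proof.
move=> f0 f1 x y xy; rewrite -lee_fin !lattice_df_fin//; apply: le_esum => k _.
by case: ifPn => kx; [rewrite (le_trans kx xy)|case: ifP].
Qed.

(** Both sides are the double sum of g k * f (m - k) over all k and all
    m <= x. *)
Lemma df_conv_lattice (f g : int -> \bar R) (G : cumulativeBounded (0 : R) (1 : R)) :
  (forall k, 0 <= f k) -> \esum_(k in [set: int]) f k = 1 ->
  (forall k, 0 <= g k) -> \esum_(k in [set: int]) g k = 1 ->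
  (forall phi : measurableTypeR R -> \bar R,
    measurable_fun setT phi -> (forall y, 0 <= phi y) ->
    \int[lebesgue_stieltjes_measure G]_y phi y =
    \esum_(k in [set: int]) (g k * phi k%:~R%R)) ->
  df_conv (lattice_df f) G = lattice_df (iconv f g).
Proof.
move=> f0 f1 g0 g1 intG; apply/funext => x; apply: EFin_inj.
have fg1 : \esum_(k in [set: int]) iconv f g k = 1 by rewrite esum_iconv// f1 g1 mul1e.
rewrite lattice_df_fin//; last exact: iconv_ge0.
rewrite /df_conv /Rintegral intG; last 2 first.
- apply/measurable_EFinP; apply: (measurableT_comp (f := lattice_df f)).
    by apply: nondecreasing_measurable => //; exact: lattice_df_nondecreasing.
  exact: measurable_funB.
- by move=> y; rewrite lattice_df_fin// esum_ge0// => k _; case: ifP.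
have E : \esum_(k in [set: int]) (g k * (lattice_df f (x - k%:~R))%:E) =
    \esum_(m in [set: int]) (if (m%:~R <= x)%R then iconv f g m else 0).
  transitivity (\esum_(k in [set: int]) \esum_(m in [set: int])
      (if (m%:~R <= x)%R then g k * f (m - k)%R else 0)).
    apply: eq_esum => k _; rewrite lattice_df_fin// -esumZl//; last first.
      by move=> m; case: ifP.
    rewrite [LHS](esum_shift _ k); apply: eq_esum => m _.
    by rewrite intrB lerD2r; case: ifP; rewrite ?mule0.
  rewrite exchange_esum; last by move=> k m; case: ifP => // _; rewrite mule_ge0.
  apply: eq_esum => m _; case: ifP => _; first by rewrite iconvC.
  by rewrite esum1.
rewrite E fineK// -lattice_df_fin//; exact: iconv_ge0.
Qed.

Lemma df_nconv_lattice (g : int -> \bar R) n : (forall k, 0 <= g k) ->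
  \esum_(k in [set: int]) g k = 1 ->
  exists G : cumulativeBounded (0 : R) (1 : R),
    df_nconv G n = lattice_df (iconv_pow g n.-1).
Proof.
move=> g0 g1; have [G GE intG] := discrete_df g0 g1; exists G.
rewrite /df_nconv; elim: n.-1 => [|m IH]; first by rewrite GE.
rewrite iterS IH /iconv_pow iterS -/(iconv_pow _ _).
apply: df_conv_lattice => //; first exact: iconv_pow_ge0.
by rewrite esum_iconv_pow// g1; elim: m.+1 => // k IHk; rewrite expeS IHk mule1.
Qed.

Lemma infinitely_divisible_lattice (q : int -> R) : profile (right_part q) ->
  profile (right_part (reflect_int q)) ->
  \esum_(k in [set: int]) (q k)%:E = 1 -> infinitely_divisible (int_df q).
Proof.
move=> mr ml q1 n n0.
have [g [g0 g1 gn]] := root_decomposition n0 mr ml q1.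
have [G GE] := df_nconv_lattice n g0 g1.
by exists G => x; rewrite GE gn.
Qed.

End DiscreteDf.

(** * The mixture with the unit mass at the origin *)

Section Mixture.
Context {R : realType}.

Definition mix_origin (alpha : R) (p : int -> R) (k : int) : R :=
  alpha * (k == 0)%:R + (1 - alpha) * p k.

(** The predicate C selects either all integers, for the total mass, or those at
    most x, for the distribution function. *)
Lemma esum_mix_origin (alpha : R) (p : int -> R) (C : pred int) :
  0 <= alpha -> alpha <= 1 -> (forall k, 0 <= p k) ->
  (\esum_(k in [set: int]) (if C k then (mix_origin alpha p k)%:E else 0) =
  alpha%:E * (C 0)%:R%:E +
  (1 - alpha)%:E * \esum_(k in [set: int]) (if C k then (p k)%:E else 0))%E.
Proof.
move=> a0 a1 p0; have a1' : 0 <= 1 - alpha by rewrite subr_ge0.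
have -> : ((C 0)%:R%:E = \esum_(k in [set: int]) ((C k && (k == 0))%:R%:E : \bar R))%E.
  rewrite -(@esum_set1 R int 0 (fun k => (C k)%:R%:E)) ?lee_fin//.
  rewrite esum_mkcond; apply: eq_esum => k _.
  have [->|k0] := eqVneq k 0; first by rewrite mem_set// andbT.
  by rewrite memNset ?andbF// => /eqP; rewrite (negbTE k0).
rewrite -!esumZl ?lee_fin//.
- rewrite -esumD; last 2 first.
  + by move=> k _; rewrite mule_ge0 ?lee_fin.
  + by move=> k _; rewrite mule_ge0 ?lee_fin//; case: ifP => // _; rewrite lee_fin.
  apply: eq_esum => k _; case: ifP => _; last by rewrite !mule0 adde0.
  by rewrite -!EFinM -EFinD.
- by move=> k; case: ifP => //; rewrite lee_fin.
Qed.

Lemma mixture_df (alpha : R) (p : int -> R) (x : R) :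
  0 <= alpha -> alpha <= 1 -> (forall k, 0 <= p k) ->
  (\esum_(k in [set: int]) (p k)%:E = 1)%E ->
  alpha * degenerate_df 0 x + (1 - alpha) * int_df p x =
  int_df (mix_origin alpha p) x.
Proof.
move=> a0 a1 p0 p1; have m0 k : 0 <= mix_origin alpha p k.
  by rewrite addr_ge0 ?mulr_ge0 ?subr_ge0.
have m1 : (\esum_(k in [set: int]) (mix_origin alpha p k)%:E = 1)%E.
  have := esum_mix_origin predT a0 a1 p0; rewrite /= p1 => ->.
  by rewrite !mule1 -EFinD addrC subrK.
apply: EFin_inj; rewrite -[int_df (mix_origin _ _) x]/(lattice_df (EFin \o mix_origin alpha p) x).
rewrite -[int_df p x]/(lattice_df (EFin \o p) x).
rewrite EFinD !EFinM !lattice_df_fin//; [|by move=> k; rewrite lee_fin..].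
rewrite (esum_mix_origin (fun k => k%:~R <= x))//; congr (_ * _ + _)%E.
rewrite /degenerate_df diracE; congr EFin.
have [x0|x0] := boolP ((0 : int)%:~R <= x); first by rewrite mem_set//= in_itv.
by rewrite memNset//= in_itv; exact/negP.
Qed.

Lemma sum_image_le1 (q : int -> R) (e : nat -> int) n : injective e ->
  (forall k, 0 <= q k) -> (\esum_(k in [set: int]) (q k)%:E = 1)%E ->
  \sum_(0 <= k < n) q (e k) <= 1.
Proof.
move=> inje q0 q1; rewrite -lee_fin -sumEFin.
apply: (@le_trans _ _ (\sum_(0 <= k <oo) (q (e k))%:E)%E).
  by apply: nneseries_lim_ge => k _; rewrite lee_fin.
rewrite nneseries_esumT; last by move=> k; rewrite lee_fin.
rewrite -(@esum_image R _ _ _ e (EFin \o q)); last by move=> i j _ _; exact: inje.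
rewrite -q1 esum_mkcond; apply: le_esum => k _.
by case: ifP => _ //; rewrite lee_fin.
Qed.

(** Here P is one side of the original distribution.  For k >= 1 the drop of the
    mixture at k is (1 - alpha) w_{k+1} / K, and at 0 it is at least
    (1 - alpha) w_1 / K; enlarging the first term of a log-convex sequence keeps
    it log-convex. *)
Lemma profile_mixture (P w : nat -> R) (K alpha : R) : 0 < K ->
  0 <= alpha -> alpha <= 1 -> (forall k, 0 <= P k) ->
  (forall j, (0 < j)%N -> 0 <= w j) -> log_convex w ->
  (forall k, (0 < k)%N -> (K * P k)%:E = (\sum_(k.+1 <= j <oo) (w j)%:E)%E) ->
  ((\sum_(1 <= j <oo) (w j)%:E)%E <= (K * P 0%N)%:E)%E ->
  (forall n, \sum_(0 <= k < n) (alpha * (k == 0%N)%:R + (1 - alpha) * P k) <= 1) ->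
  profile (fun k => alpha * (k == 0%N)%:R + (1 - alpha) * P k).
Proof.
move=> K0 a0 a1 P0 w0 lw PE PE0 sum1.
set a := fun k => _ : R.
have a1' : 0 <= 1 - alpha by rewrite subr_ge0.
have age0 k : 0 <= a k by rewrite addr_ge0// mulr_ge0.
have split k : ((\sum_(k.+1 <= j <oo) (w j)%:E) =
    (w k.+1)%:E + \sum_(k.+2 <= j <oo) (w j)%:E)%E.
  rewrite (nneseries_split k.+1 1); last by move=> j kj; rewrite lee_fin w0// (leq_trans _ kj).
  by rewrite addn1 big_nat1.
have dP k : (0 < k)%N -> P k - P k.+1 = w k.+1 / K.
  move=> k0; have := PE k k0; rewrite split -PE// -EFinD => -[E].
  have -> : w k.+1 = K * (P k - P k.+1) by rewrite mulrBr E; ring.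
  by rewrite mulrAC mulfV ?mul1r// gt_eqF.
have dP0 : w 1%N / K <= P 0%N - P 1%N.
  rewrite ler_pdivrMr// mulrC mulrBr lerBrDr -lee_fin EFinD PE//.
  by rewrite -split.
have da k : (0 < k)%N -> drop_of a k = (1 - alpha) * (w k.+1 / K).
  case: k => // k _; rewrite -dP// /drop_of /a /=; ring.
have da0 : (1 - alpha) * (w 1%N / K) <= drop_of a 0.
  apply: le_trans (ler_wpM2l a1' dP0) _.
  by rewrite /drop_of /a /= mulr0 add0r mulr1; lra.
have wK k : 0 <= w k.+1 / K by rewrite divr_ge0 ?w0// ltW.
split => //.
- case=> [|k]; last by rewrite da// mulr_ge0.
  by apply: le_trans da0; rewrite mulr_ge0.
- have lw' k : ((1 - alpha) * (w k.+2 / K)) ^+ 2 <=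
      ((1 - alpha) * (w k.+1 / K)) * ((1 - alpha) * (w k.+3 / K)).
    have -> : ((1 - alpha) * (w k.+1 / K)) * ((1 - alpha) * (w k.+3 / K)) =
        ((1 - alpha) / K) ^+ 2 * (w k.+1 * w k.+3) by ring.
    have -> : ((1 - alpha) * (w k.+2 / K)) ^+ 2 =
        ((1 - alpha) / K) ^+ 2 * w k.+2 ^+ 2 by ring.
    by rewrite ler_wpM2l ?sqr_ge0// lw.
  case=> [|k]; last by rewrite !da.
  rewrite (da 1%N)// (da 2%N)//; apply: le_trans (lw' 0%N) _.
  by rewrite ler_wpM2r// mulr_ge0.
- apply: nondecreasing_is_cvgn; last by exists 1 => _ [n _ <-]; exact: sum1.
  by apply/nondecreasing_seqP => n; rewrite /series/= big_nat_recr//= lerDl.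
Qed.

End Mixture.

Unset Implicit Arguments.

Theorem corollary3p1 (R : realType) (p : int -> R)
    (p_distr : int_distribution p) (p_nondeg : nondegenerate_distribution p)
    (K : R) (K_gt0 : 0 < K)
    (v : int -> R) (v_ge0 : forall j : int, j != 0 -> 0 <= v j)
    (v_neg_log_convex : log_convex (fun j : nat => v (- j%:Z)))
    (v_pos_log_convex : log_convex (fun j : nat => v j%:Z))
    (p_neg : forall x : int, x < 0 ->
      (K * p x)%:E = (\sum_(`|x|.+1 <= j <oo) (v (- j%:Z))%:E)%E)
    (p_pos : forall x : int, 0 < x ->
      (K * p x)%:E = (\sum_(`|x|.+1 <= j <oo) (v j%:Z)%:E)%E)
    (p_zero : (K * p 0)%:E =
      maxe (\sum_(1 <= j <oo) (v (- j%:Z))%:E)%E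
           (\sum_(1 <= j <oo) (v j%:Z)%:E)%E)
    (alpha : R) (alpha_ge0 : 0 <= alpha) (alpha_le1 : alpha <= 1) :
  infinitely_divisible
    (fun x : R => alpha * degenerate_df 0 x + (1 - alpha) * int_df p x).
Proof.
have [p0 p1] := p_distr; pose q := mix_origin alpha p.
have q0 k : 0 <= q k by rewrite addr_ge0 ?mulr_ge0 ?subr_ge0.
have q1 : (\esum_(k in [set: int]) (q k)%:E = 1)%E.
  have := esum_mix_origin predT alpha_ge0 alpha_le1 p0; rewrite /= p1 => ->.
  by rewrite !mule1 -EFinD addrC subrK.
have -> : (fun x : R => alpha * degenerate_df 0 x + (1 - alpha) * int_df p x) =
    int_df q.
  by apply/funext => x; exact: mixture_df.
apply: (infinitely_divisible_lattice _ _ q1).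
- apply: (@profile_mixture R (fun k => p k%:Z) (fun j => v j%:Z) K) => //.
  + by case=> // j _; exact: v_ge0.
  + by move=> k k0; rewrite p_pos// absz_nat.
  + by rewrite p_zero le_max lexx orbT.
  + by move=> n; apply: (@sum_image_le1 R q Posz) => // i j [].
- have -> : right_part (reflect_int q) =
      fun k => alpha * (k == 0%N)%:R + (1 - alpha) * p (- k%:Z).
    by apply/funext => k; rewrite /right_part /reflect_int /q /mix_origin oppr_eq0.
  apply: (@profile_mixture R (fun k => p (- k%:Z)) (fun j => v (- j%:Z)) K) => //.
  + by case=> // j _; exact: v_ge0.
  + by move=> k k0; rewrite p_neg ?oppr_lt0// abszN absz_nat.
  + by rewrite oppr0 p_zero le_max lexx.
  + move=> n; rewrite (eq_bigr (fun k : nat => q (- k%:Z))); last first.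
      by move=> k _; rewrite /q /mix_origin oppr_eq0.
    by apply: (@sum_image_le1 R q (fun k => - k%:Z)) => // i j /oppr_inj[].
Qed.
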